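(* Let $h\in\mathbf{H}^1$ be a point of the first Heisenberg group, viewed in its Siegel model $\mathfrak S^1$. Then the following are equivalent: 1. $h\in\mathbf{BA}_{\mathfrak S^1}$, i.e. $h$ is badly approximable with respect to the Siegel height: there is $C>0$ such that $d(h,y)>C\,\mathrm{ht}_{\mathfrak S^1}(y)^{-1}$ for all $y\in\mathfrak S^1(\mathbb{Q})$. 2. $h\in\mathbf{BD}$, i.e. the Heisenberg continued fraction digits $\gamma_i$ of $h$ are bounded in norm: $\sup_i\|\gamma_i\|<\infty$. 3. $h\in D(\Gamma)$, i.e. $h$ is the endpoint of a geodesic ray in complex hyperbolic space $\mathbb{H}^2_{\mathbb{C}}$ whose image in $\Gamma\backslash\mathbb{H}^2_{\mathbb{C}}$ is contained in some compact subset, where $\Gamma=U(2,1;\mathbb{Z}[i])$.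
   Context: Siegel model of the first Heisenberg group $\mathbf{H}^1$: $\mathfrak S^1=\{(u,v)\in\mathbb{C}^2:2\,\mathrm{Re}(v)=|u|^2\}$, group law $(u,v)*(u',v')=(u+u',v+v'+\overline u u')$, norm $\|(u,v)\|=|v|^{1/2}$, metric $d(h,h')=\|h^{-1}*h'\|$. $\mathfrak S^1(\mathbb{Z})=\mathfrak S^1\cap\mathbb{Z}[i]^2$, $\mathfrak S^1(\mathbb{Q})=\mathfrak S^1\cap\mathbb{Q}[i]^2$. The Siegel height $\mathrm{ht}_{\mathfrak S^1}(y)$ of $y\in\mathfrak S^1(\mathbb{Q})$ is the minimum of $|q|$ over all representations $y=(r/q,p/q)$ with $r,p,q\in\mathbb{Z}[i]$, $q\ne0$. Continued fractions: let $\iota(u,v)=(-u/v,1/v)$ be the Koranyi inversion (defined for $(u,v)\ne(0,0)$). Let $K\subset\mathfrak S^1$ be the Dirichlet region of $\mathfrak S^1(\mathbb{Z})$ centered at the origin, i.e. the set of points closer to $0$ than to any other point of $\mathfrak S^1(\mathbb{Z})$, together with a fixed choice of boundary so that the translates $\gamma*K$, $\gamma\in\mathfrak S^1(\mathbb{Z})$, partition $\mathfrak S^1$. For $h\in\mathfrak S^1$, $[h]\in\mathfrak S^1(\mathbb{Z})$ is the element with $h\in[h]*K$. The Gauss map $T:K\to K$ is $T(0)=0$ and $T(h)=[\iota(h)]^{-1}*\iota(h)$ for $h\ne0$. The continued fraction digits of $h$ are $\gamma_0=[h]$ and, with $h_0=[h]^{-1}*h\in K$ and $h_i=T^ih_0$,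 $\gamma_i=[\iota(h_{i-1})]$ for $i\ge1$ as long as $h_{i-1}\neq0$. The digit sequence is finite exactly when $h\in\mathfrak S^1(\mathbb{Q})$. Complex hyperbolic plane: $\mathbb{H}^2_{\mathbb{C}}=\{(u,v)\in\mathbb{C}^2:2\,\mathrm{Re}(v)>|u|^2\}$ with its complex hyperbolic (Bergman) metric, which is invariant under the group $U(2,1)$ of complex linear maps preserving the Hermitian form associated with $|z_2|^2-2\,\mathrm{Re}(\overline{z_1}z_3)$, acting projectively on $[z_1:z_2:z_3]=[1:u:v]$. Its boundary at infinity is $\mathfrak S^1\cup\{\infty\}$. $\Gamma=U(2,1;\mathbb{Z}[i])$ is the subgroup of elements with Gaussian integer entries (the Picard modular group); it is generated by $\iota$, the rotation $(u,v)\mapsto(iu,v)$, and the left translations $(u,v)\mapsto(u+a,v+b+\overline a u)$ with $(a,b)\in\mathfrak S^1(\mathbb{Z})$.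
   Formalization: In condition 2 the digit sequence is required to be infinite as well as bounded: points with a finite digit sequence (the rational points, e.g. h=0) are counted as not in BD, since otherwise they would satisfy 2 but not 1 or 3. *)

(* Defs.v *)
From HB Require Import structures.
From mathcomp Require Import all_boot all_order all_algebra.
From mathcomp Require Import generic_quotient complex.
From mathcomp Require Import all_classical all_reals all_analysis.
Set Implicit Arguments.
Unset Strict Implicit.
Unset Printing Implicit Defensive.
Import Order.TTheory GRing.Theory Num.Theory numFieldNormedType.Exports.
Import ComplexField.

Local Open Scope classical_set_scope.
Local Open Scope ring_scope.
Local Open Scope complex_scope.

(* [R[i]^o] is [R[i]] with its norm topology, so [C2 R] carries the usual
   topology of C^2.  Moduli are taken in [R] by means of [Normc.normc], since
   [`|z|] lives in [R[i]]. *)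
Notation C2 R := (R[i]^o * R[i]^o)%type.

Section Siegel.
Variable R : realType.
Implicit Types (z : R[i]) (h g y : C2 R) (K : set (C2 R)).

Definition siegel : set (C2 R) :=
  [set h | complex.Re h.2 *+ 2 = Normc.normc h.1 ^+ 2].

Definition heis_mul h g : C2 R := (h.1 + g.1, h.2 + g.2 + (h.1)^*%C * g.1).

(* The inverse of [h] for [heis_mul] when [h] is in [siegel]. *)
Definition heis_inv h : C2 R := (- h.1, (h.2)^*%C).

Definition heis_norm h : R := Num.sqrt (Normc.normc h.2).

Definition heis_dist h g : R := heis_norm (heis_mul (heis_inv h) g).

Definition gaussian_int z : Prop :=
  complex.Re z \is a Num.int /\ complex.Im z \is a Num.int.

Definition gaussian_rat z : Prop :=
  range (@ratr R) (complex.Re z) /\ range (@ratr R) (complex.Im z).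

Definition siegelZ : set (C2 R) :=
  siegel `&` [set h | gaussian_int h.1 /\ gaussian_int h.2].

Definition siegelQ : set (C2 R) :=
  siegel `&` [set h | gaussian_rat h.1 /\ gaussian_rat h.2].

Definition is_denominator y (q : R[i]) : Prop :=
  [/\ gaussian_int q, q != 0 &
      exists r p : R[i], [/\ gaussian_int r, gaussian_int p &
        y = (r / q, p / q)]].

(* The infimum is a minimum for [y] in [siegelQ]: squared moduli of Gaussian
   integers are natural numbers. *)
Definition siegel_height y : R :=
  inf [set Normc.normc q | q in is_denominator y].

Definition badly_approximable h : Prop :=
  exists2 C : R, 0 < C &
    forall y, siegelQ y -> C * (siegel_height y)^-1 < heis_dist h y.

Definition koranyi_inv h : C2 R := (- h.1 / h.2, 1 / h.2).

(* [K] is the Dirichlet region of [siegelZ] centered at the origin together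
   with a choice of boundary: an arbitrary set of points among those which are
   equidistant from the origin and from another nearest lattice point, subject
   to the translates of [K] forming a partition. *)
Definition dirichlet_region K : Prop :=
  [/\ [set h | siegel h /\ forall g, siegelZ g -> g != 0 ->
               heis_dist h 0 < heis_dist h g] `<=` K,
      K `<=` [set h | siegel h /\ forall g, siegelZ g -> g != 0 ->
                      heis_dist h 0 <= heis_dist h g] &
      partition siegelZ (fun g => heis_mul g @` K) siegel].

Definition nearest_int K h : C2 R :=
  xget 0 [set g | siegelZ g /\ (heis_mul g @` K) h].

Definition frac_part K h : C2 R := heis_mul (heis_inv (nearest_int K h)) h.

Definition gauss_map K h : C2 R :=
  if h == 0 then 0 else frac_part K (koranyi_inv h).

Definition cf_remainder K h (i : nat) : C2 R :=
  iter i (gauss_map K) (frac_part K h).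

(* [None] past the end of a finite expansion. *)
Definition cf_digit K h (i : nat) : option (C2 R) :=
  if i is j.+1 then
    if cf_remainder K h j == 0 then None
    else Some (nearest_int K (koranyi_inv (cf_remainder K h j)))
  else Some (nearest_int K h).

(* All the digits must exist: a finite expansion, which is that of a point of
   [siegelQ], is regarded as ending with an infinite digit (the image of the
   origin under the Koranyi inversion is the point at infinity). *)
Definition bounded_digits K h : Prop :=
  exists M : R, forall i : nat,
    exists2 g, cf_digit K h i = Some g & heis_norm g <= M.

End Siegel.

Section ComplexHyperbolicPlane.
Variable R : realType.
Implicit Types (z w : 'cV[R[i]]_3) (A B : 'M[R[i]]_3).

Definition hermitian_form z w : R[i] :=
  z 1 0 * (w 1 0)^*%C - z 0 0 * (w 2 0)^*%C - z 2 0 * (w 0 0)^*%C.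

Definition homogeneous (p : C2 R) : 'cV[R[i]]_3 :=
  \col_i [:: 1; p.1; p.2]`_i.

Definition picard_group : set 'M[R[i]]_3 :=
  [set A : 'M[R[i]]_3 | (forall i j, gaussian_int (A i j)) /\
           forall z w, hermitian_form (A *m z) (A *m w) = hermitian_form z w].

(* As a type, [hplane] has the topology induced by that of C^2. *)
Definition hplane : set (C2 R) :=
  [set p | Normc.normc p.1 ^+ 2 < complex.Re p.2 *+ 2].

Definition arcosh (x : R) : R := ln (x + Num.sqrt (x ^+ 2 - 1)).

(* The distance of the Bergman metric,
     cosh^2 (d / 2) = <z, w> <w, z> / (<z, z> <w, w>),
   normalized so that the sectional curvature lies in [-1, -1/4]. *)
Definition hyp_dist (x y : hplane) : R :=
  let z := homogeneous (val x) in
  let w := homogeneous (val y) in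
  2 * arcosh (Normc.normc (hermitian_form z w) /
    Num.sqrt (complex.Re (hermitian_form z z * hermitian_form w w))).

(* Equality of projective points: [A] maps the line of [x] to that of [y]. *)
Definition same_orbit (x y : hplane) : bool :=
  `[< exists2 A, picard_group A & exists2 l : R[i], l != 0 &
        A *m homogeneous (val x) = l *: homogeneous (val y) >].

Lemma gaussian_int_bool (b : bool) : gaussian_int (b%:R : R[i]).
Proof. by case: b; split; rewrite /= ?rpred0 ?rpred1. Qed.

Lemma same_orbit_refl : reflexive same_orbit.
Proof.
move=> x; apply/asboolP; exists 1%:M; last first.
  by exists 1; rewrite ?oner_neq0// mul1mx scale1r.
split=> [i j|z w]; last by rewrite !mul1mx.
by rewrite mxE; exact: gaussian_int_bool.
Qed.

Lemma gaussian_intD (a b : R[i]) :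
  gaussian_int a -> gaussian_int b -> gaussian_int (a + b).
Proof.
by case: a b => [a a'] [b b'] [/= ? ?] [/= ? ?]; split; rewrite /= rpredD.
Qed.

Lemma gaussian_intM (a b : R[i]) :
  gaussian_int a -> gaussian_int b -> gaussian_int (a * b).
Proof.
case: a b => [a a'] [b b'] [/= ? ?] [/= ? ?]; split => /=.
  by rewrite rpredB ?rpredM.
by rewrite rpredD ?rpredM.
Qed.

Lemma gaussian_intN (a : R[i]) : gaussian_int a -> gaussian_int (- a).
Proof. by case: a => [a a'] [/= ? ?]; split; rewrite /= rpredN. Qed.

Lemma gaussian_int_conj (a : R[i]) : gaussian_int a -> gaussian_int (a^*%C).
Proof. by case: a => [a a'] [/= ? ?]; split; rewrite /= ?rpredN. Qed.

Lemma gaussian_int_sum n (F : 'I_n -> R[i]) :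
  (forall i, gaussian_int (F i)) -> gaussian_int (\sum_i F i).
Proof.
move=> FZ; apply: (big_ind (@gaussian_int R)) => //; last exact: gaussian_intD.
by split; rewrite /= rpred0.
Qed.

Lemma picard_groupM A B :
  picard_group A -> picard_group B -> picard_group (A *m B).
Proof.
move=> [AZ AU] [BZ BU]; split=> [i j|z w]; last by rewrite -!mulmxA AU BU.
by rewrite mxE; apply: gaussian_int_sum => k; exact: gaussian_intM.
Qed.

Lemma same_orbit_trans : transitive same_orbit.
Proof.
move=> y x z /asboolP[A PA [l l0 Al]] /asboolP[B PB [m m0 Bm]].
apply/asboolP; exists (B *m A); first exact: picard_groupM.
exists (l * m); first by rewrite mulf_neq0.
by rewrite -mulmxA Al -scalemxAr Bm scalerA.
Qed.

Definition form_mx : 'M[R[i]]_3 :=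
  \matrix_(i, j) (if i == 1 then (j == 1)%:R
                  else - ((i != j) && (j != 1))%:R).

Lemma sum_ord3 (F : 'I_3 -> R[i]) : \sum_i F i = F 0 + F 1 + F 2.
Proof.
rewrite !big_ord_recl big_ord0 addr0 addrA.
by congr (_ + _ + _); congr (F _); exact/val_inj.
Qed.

Lemma hermitian_formE z w :
  hermitian_form z w = (z^T *m form_mx *m map_mx conjc w) 0 0.
Proof.
rewrite mxE sum_ord3 !mxE !sum_ord3 !mxE /= /hermitian_form.
rewrite !(mulr0, mulr1, addr0, add0r, oppr0, mulrN1, mulNr).
by rewrite -addrA [- _ - _]addrC [RHS]addrAC [RHS]addrC.
Qed.

Lemma form_mxK : form_mx *m form_mx = 1%:M.
Proof.
apply/matrixP => i j; rewrite mxE sum_ord3 !mxE /=.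
case: i j => [[|[|[|//]]] ?] [[|[|[|//]]] ?] /=;
by rewrite ?(mulr0, mul0r, mulr1, addr0, add0r, oppr0, mulrNN).
Qed.

Lemma mxform_inj (M N : 'M[R[i]]_3) :
  (forall z w, (z^T *m M *m w) 0 0 = (z^T *m N *m w) 0 0) -> M = N.
Proof.
move=> MN; apply/matrixP => i j; have := MN (delta_mx i 0) (delta_mx j 0).
by rewrite !trmx_delta -!rowE -!colE !mxE.
Qed.

Lemma picard_groupV A : picard_group A ->
  exists2 B, picard_group B & B *m A = 1%:M.
Proof.
move=> [AZ AU]; pose conj_mx (M : 'M[R[i]]_3) := map_mx conjc M.
have conjK (M : 'M[R[i]]_3) : conj_mx (conj_mx M) = M.
  by apply/matrixP => i j; rewrite !mxE conjcK.
have AJ : A^T *m form_mx *m conj_mx A = form_mx.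
  apply: mxform_inj => z w.
  have := AU z (map_mx conjc w); rewrite !hermitian_formE trmx_mul map_mxM /=.
  rewrite (_ : map_mx conjc (map_mx conjc w) = w) ?mulmxA//.
  by apply/matrixP => i j; rewrite !mxE conjcK.
have BA : form_mx *m (conj_mx A)^T *m form_mx *m A = 1%:M.
  rewrite -form_mxK -!mulmxA; congr (_ *m _).
  have := congr1 conj_mx AJ; rewrite {1 3}/conj_mx !map_mxM /=.
  rewrite -!/(conj_mx _) conjK mulmxA.
  have -> : conj_mx form_mx = form_mx.
    apply/matrixP => i j; rewrite !mxE.
    by case: ifP => _; rewrite ?rmorphN rmorph_nat.
  by rewrite map_trmx.
have AB := mulmx1C BA.
exists (form_mx *m (conj_mx A)^T *m form_mx) => //; split=> [i j|z w].
  have JZ k l : gaussian_int (form_mx k l).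
    rewrite mxE; case: ifP => _; last apply: gaussian_intN;
    exact: gaussian_int_bool.
  do 2 (rewrite mxE; apply: gaussian_int_sum => ?; apply: gaussian_intM => //).
  by rewrite !mxE; exact: gaussian_int_conj.
by rewrite -AU (mulmxA A _ z) (mulmxA A _ w) AB !mul1mx.
Qed.

Lemma same_orbit_sym : symmetric same_orbit.
Proof.
suff sym x y : same_orbit x y -> same_orbit y x.
  by move=> x y; apply/idP/idP; exact: sym.
move=> /asboolP[A PA [l l0 Al]].
have [B PB BA] := picard_groupV PA.
apply/asboolP; exists B => //; exists l^-1; first by rewrite invr_neq0.
apply: (scalerI l0); rewrite scalerA divff// scale1r.
by rewrite scalemxAr -Al mulmxA BA mul1mx.
Qed.

Definition same_orbit_equiv : equiv_rel hplane :=
  EquivRel same_orbit same_orbit_refl same_orbit_sym same_orbit_trans.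

(* The orbit space of [hplane] under [picard_group]. *)
Definition picard_quotient : topologicalType :=
  quotient_topology {eq_quot same_orbit_equiv}%qT.

Definition orbit_of (x : hplane) : picard_quotient :=
  \pi_({eq_quot same_orbit_equiv})%qT x.

Definition geodesic_ray (c : R -> hplane) : Prop :=
  forall s t, 0 <= s -> 0 <= t -> hyp_dist (c s) (c t) = `|s - t|.

(* [D(Gamma)].  For endpoints [h] in [siegel], convergence in the closed ball
   compactifying [hplane] amounts to convergence in C^2. *)
Definition bounded_ray_endpoint (h : C2 R) : Prop :=
  exists c : R -> hplane,
    [/\ geodesic_ray c,
        (val (c t) : C2 R) @[t --> +oo] --> h &
        exists2 Q : set picard_quotient, compact Q &
          forall t, 0 <= t -> Q (orbit_of (c t))].

End ComplexHyperbolicPlane.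

(* Main.v *)
From HB Require Import structures.
Require Import Defs.
From mathcomp Require Import all_boot all_order all_algebra complex.
From mathcomp Require Import generic_quotient ring lra.
From mathcomp Require Import all_classical all_reals all_analysis.
Set Implicit Arguments.
Unset Strict Implicit.
Unset Printing Implicit Defensive.
Import Order.TTheory GRing.Theory Num.Theory numFieldNormedType.Exports.
Import ComplexField.

Local Open Scope classical_set_scope.
Local Open Scope ring_scope.
Local Open Scope complex_scope.

(* A primitive null vector [w = (q, r, p)] of Z[i]^3 is both a rational point
   [(r / q, p / q)] and a cusp of the Picard group, and
   [d(h, (r / q, p / q))^2 |q|^2 = |<w, h>| |q|]; so [h] is badly approximable iff
   [|<w, h>| |q|] is bounded below.

   Geodesic rays: [|<x, w>|^2 / |<x, x>|] measures the depth of [x] in the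
   horoball at [w].  The point of the vertical ray ending at [h] whose height is
   [d(h, (r / q, p / q))^2] makes it comparable with [|<w, h>| |q|], and any ray
   ending at [h] is asymptotic to the vertical one.  A set of points outside deep
   horoballs has relatively compact image in the quotient, by maximizing the
   depth over the orbit: translations of Z[i] bring any boundary point within
   [|v| <= 3/4 < 1] of the origin, where the inversion would increase the depth.

   Continued fractions: let [A_n] in the Picard group map [h] to
   [l_n * h_n], with [h_n = (u_n, v_n)] the [n]-th remainder; then
   [|l_(n+1)| = |l_n| |v_n|].  By induction on [n], using [|v_n| <= 3/4] and the
   triangle inequality, the denominators [q_n] of the convergents satisfy
   [|q_n| |l_n| <= 12] and [|q_(n+1)| |l_n| <= 16].  Hence the next convergent
   shows that a small [v_n], i.e. a large digit, is a good approximation of [h].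
   Conversely, if all the [|v_n|] are bounded below, then [A_n] moves the points
   of the vertical ray at heights between [|l_(n+1)|^2 / 24] and [|l_n|^2 / 24]
   to points of bounded depth. *)

(** * Real-valued moduli of complex numbers *)

Section ComplexModulus.
Variable R : realType.
Local Notation nm := (@Normc.normc R).
Implicit Types z w : R[i].

Lemma modulus_ge0 z : 0 <= nm z.
Proof. by case: z => a b; exact: sqrtr_ge0. Qed.

Lemma modulus_sqr z : nm z ^+ 2 = complex.Re z ^+ 2 + complex.Im z ^+ 2.
Proof. by case: z => a b /=; rewrite sqr_sqrtr// addr_ge0// sqr_ge0. Qed.

Lemma modulusJ z : nm z^*%C = nm z.
Proof. by case: z => a b /=; rewrite sqrrN. Qed.

Lemma modulusD z w : nm (z + w) <= nm z + nm w.
Proof. exact: le_normcD. Qed.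

Lemma modulusB z w : nm (z - w) <= nm z + nm w.
Proof. by rewrite -(normcN w); exact: le_normcD. Qed.

Lemma modulusBC z w : nm (z - w) = nm (w - z).
Proof. by rewrite -opprB normcN. Qed.

Lemma modulus_eq0 z : (nm z == 0) = (z == 0).
Proof.
by apply/eqP/eqP => [/Normc.eq0_normc //|->]; rewrite Normc.normc0.
Qed.

Lemma modulus_gt0 z : (0 < nm z) = (z != 0).
Proof. by rewrite lt_def modulus_ge0 modulus_eq0 andbT. Qed.

Lemma Re_le_modulus z : complex.Re z <= nm z.
Proof.
rewrite (le_trans (ler_norm _))// -ler_sqr ?nnegrE ?modulus_ge0// modulus_sqr.
by rewrite real_normK ?num_real// lerDl sqr_ge0.
Qed.

Lemma modulus_real (x : R) : 0 <= x -> nm x%:C = x.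
Proof. by move=> x0 /=; rewrite expr0n addr0 sqrtr_sqr ger0_norm. Qed.

Lemma modulusM z w : nm (z * w) = nm z * nm w.
Proof. exact: Normc.normcM. Qed.

Lemma modulusV z : nm z^-1 = (nm z)^-1.
Proof. exact: Normc.normcV. Qed.

(** Product of the two bounds, regrouped as it is needed when both come from vectors on which the
    Hermitian form is nonpositive. *)
Lemma mul_le_sqrt_double (a b x y x' y' : R) :
    0 <= a -> 0 <= b -> 0 <= x -> 0 <= y -> 0 <= x' -> 0 <= y' ->
    a ^+ 2 <= (x * y) *+ 2 -> b ^+ 2 <= (x' * y') *+ 2 ->
  a * b <= (Num.sqrt (y * y') * Num.sqrt (x * x')) *+ 2.
Proof.
move=> a0 b0 x0 y0 x'0 y'0 Ha Hb.
have S0 : 0 <= (Num.sqrt (y * y') * Num.sqrt (x * x')) *+ 2.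
  by rewrite mulrn_wge0// mulr_ge0 ?sqrtr_ge0.
rewrite -ler_sqr ?nnegrE ?mulr_ge0//.
rewrite -mulr_natr !exprMn !sqr_sqrtr ?mulr_ge0//.
apply: (le_trans (ler_pM (sqr_ge0 _) (sqr_ge0 _) Ha Hb)).
by rewrite le_eqVlt; apply/orP; left; apply/eqP; ring.
Qed.

End ComplexModulus.

(** * The Hermitian form, boundary points and depth *)

Section HermitianForm.
Variable R : realType.
Local Notation nm := (@Normc.normc R).
Local Notation hf := (@hermitian_form R).
Local Notation C := R[i].
Implicit Types (p : C2 R) (z w X : 'cV[C]_3).

Lemma hermitian_formC z w : hf w z = (hf z w)^*%C.
Proof. by rewrite /hermitian_form !(rmorphB, rmorphM) /= !conjcK; ring. Qed.

Lemma modulus_formC z w : nm (hf w z) = nm (hf z w).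
Proof. by rewrite hermitian_formC modulusJ. Qed.

Lemma hermitian_formDl z z' w : hf (z + z') w = hf z w + hf z' w.
Proof. by rewrite /hermitian_form !mxE; ring. Qed.

Lemma hermitian_formZl (a : C) z w : hf (a *: z) w = a * hf z w.
Proof. by rewrite /hermitian_form !mxE; ring. Qed.

Lemma Re_hermitian_formzz z : complex.Re (hf z z) =
  nm (z 1 0) ^+ 2 - complex.Re (z 0 0 * (z 2 0)^*%C) *+ 2.
Proof.
rewrite /hermitian_form modulus_sqr.
by case: (z 0 0) (z 1 0) (z 2 0) => [a b] [a' b'] [c d] /=; ring.
Qed.

Lemma homogeneous0 p : homogeneous p 0 0 = 1. Proof. by rewrite mxE. Qed.
Lemma homogeneous1 p : homogeneous p 1 0 = p.1. Proof. by rewrite mxE. Qed.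
Lemma homogeneous2 p : homogeneous p 2 0 = p.2. Proof. by rewrite mxE. Qed.
Definition homogeneousE := (homogeneous0, homogeneous1, homogeneous2).

Lemma siegelE p : siegel p -> p.1 * (p.1)^*%C = p.2 + (p.2)^*%C.
Proof.
case: p => [[a b] [c d]] /=; rewrite /siegel /= sqr_sqrtr ?addr_ge0 ?sqr_ge0// => H.
by apply/eqP; rewrite eq_complex /=; apply/andP; split; apply/eqP; lra.
Qed.

Lemma sqr_modulus_le_form z : complex.Re (hf z z) <= 0 ->
  nm (z 1 0) ^+ 2 <= (nm (z 0 0) * nm (z 2 0)) *+ 2.
Proof.
rewrite Re_hermitian_formzz subr_le0 => /le_trans; apply.
by rewrite lerMn2r /= (le_trans (Re_le_modulus _))// modulusM modulusJ.
Qed.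

Lemma hermitian_form_homogeneous z p :
  hf z (homogeneous p) = z 1 0 * (p.1)^*%C - z 0 0 * (p.2)^*%C - z 2 0.
Proof. by rewrite /hermitian_form !homogeneousE rmorph1 mulr1. Qed.

(** The Heisenberg translation by the inverse of [p], with the last coordinate written as a value of
    the form. *)
Definition recenter p z : 'cV[C]_3 :=
  \col_i [:: z 0 0; z 1 0 - p.1 * z 0 0; - hf z (homogeneous p)]`_i.

Lemma recenter0 p z : recenter p z 0 0 = z 0 0. Proof. by rewrite mxE. Qed.
Lemma recenter1 p z : recenter p z 1 0 = z 1 0 - p.1 * z 0 0.
Proof. by rewrite mxE. Qed.
Lemma recenter2 p z : recenter p z 2 0 = - hf z (homogeneous p).
Proof. by rewrite mxE. Qed.

Lemma hermitian_form_recenter p z w : siegel p ->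
  hf z w = hf (recenter p z) (recenter p w).
Proof.
move/siegelE => E; rewrite [RHS]/hermitian_form !recenter0 !recenter1 !recenter2.
rewrite !hermitian_form_homogeneous /hermitian_form.
rewrite !(rmorphB, rmorphN, rmorphM) /= !conjcK.
by ring: E.
Qed.

(* Translating the boundary point [p] to the origin turns [<X, w>] into a sum of
   three terms, the first of which is bounded by AM-GM. *)
Lemma form_triangle p X w : siegel p ->
    complex.Re (hf X X) <= 0 -> complex.Re (hf w w) <= 0 ->
  nm (hf X w) <= (Num.sqrt (nm (hf X (homogeneous p)) * nm (w 0 0)) +
                  Num.sqrt (nm (X 0 0) * nm (hf w (homogeneous p)))) ^+ 2.
Proof.
move=> pS; rewrite (hermitian_form_recenter X X pS) (hermitian_form_recenter w w pS).
move=> /sqr_modulus_le_form + /sqr_modulus_le_form.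
rewrite (hermitian_form_recenter X w pS) /hermitian_form.
rewrite !recenter0 !recenter2 -!/(hf _ _) !rmorphN /=.
rewrite !normcN.
move: (recenter p X 1 0) (recenter p w 1 0) => A B Ha Hb.
set x := nm (hf X _) * nm (w 0 0); set y := nm (X 0 0) * nm (hf w _).
have x0 : 0 <= x by rewrite mulr_ge0 ?modulus_ge0.
have y0 : 0 <= y by rewrite mulr_ge0 ?modulus_ge0.
have AB : nm A * nm B <= (Num.sqrt x * Num.sqrt y) *+ 2.
  apply: mul_le_sqrt_double Ha _; rewrite ?modulus_ge0//.
  by rewrite mulrC.
apply: (le_trans (modulusB _ _)); rewrite modulusM modulusJ normcN -/x.
apply: (le_trans (lerD (modulusB _ _) (lexx _))).
rewrite !modulusM normcN !modulusJ -/y sqrrD !sqr_sqrtr// addrAC.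
by rewrite lerD2r addrC lerD2l.
Qed.

(* The horospherical height over [siegel]. *)
Definition depth p : R := complex.Re p.2 *+ 2 - nm p.1 ^+ 2.

(** Twice the real part of [-<p, q>] is [depth p + depth q + |p.1 - q.1|^2]. *)
Lemma hermitian_form_ge p q :
  (depth p + depth q) / 2 <= nm (hf (homogeneous p) (homogeneous q)).
Proof.
rewrite -normcN; apply: le_trans (Re_le_modulus _).
rewrite /depth /hermitian_form !homogeneousE !modulus_sqr.
case: p q => [[a b] [c d]] [[a' b'] [c' d']] /=.
have := sqr_ge0 (a - a'); have := sqr_ge0 (b - b').
rewrite !expr2; lra.
Qed.

Lemma Re_form_homogeneous p :
  complex.Re (hf (homogeneous p) (homogeneous p)) = - depth p.
Proof.
by rewrite Re_hermitian_formzz !homogeneousE mul1r opprB; case: p.2.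
Qed.

Lemma siegel_depth0 p : siegel p <-> depth p = 0.
Proof.
by split=> [H|/eqP]; rewrite /depth ?H ?subrr// subr_eq0 => /eqP.
Qed.

Lemma hermitian_formZr (a : C) z w : hf z (a *: w) = a^*%C * hf z w.
Proof. by rewrite /hermitian_form !mxE !rmorphM /=; ring. Qed.

Lemma Re_formZ (a : C) z :
  complex.Re (hf (a *: z) (a *: z)) = nm a ^+ 2 * complex.Re (hf z z).
Proof.
rewrite hermitian_formZl hermitian_formZr modulus_sqr.
by case: a (hf z z) => [a b] [c d] /=; ring.
Qed.

Definition affine z : C2 R := (z 1 0 / z 0 0, z 2 0 / z 0 0).

Lemma affineK z : z 0 0 != 0 -> z = z 0 0 *: homogeneous (affine z).
Proof.
move=> z0; apply/matrixP => i j; rewrite ord1 !mxE.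
case: i => -[|[|[|//]]] i3 /=; rewrite ?mulr1.
- by congr (z _ _); exact/val_inj.
- by rewrite mulrC divfK//; congr (z _ _); exact/val_inj.
- by rewrite mulrC divfK//; congr (z _ _); exact/val_inj.
Qed.

Lemma cvec3P z w :
  z 0 0 = w 0 0 -> z 1 0 = w 1 0 -> z 2 0 = w 2 0 -> z = w.
Proof.
move=> H0 H1 H2; apply/matrixP => i j; rewrite ord1.
case: i => -[|[|[|//]]] i3.
- by rewrite (_ : Ordinal i3 = 0)//; exact/val_inj.
- by rewrite (_ : Ordinal i3 = 1)//; exact/val_inj.
- by rewrite (_ : Ordinal i3 = 2)//; exact/val_inj.
Qed.

Lemma depth_affine z : z 0 0 != 0 ->
  depth (affine z) = - complex.Re (hf z z) / nm (z 0 0) ^+ 2.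
Proof.
move=> z0; rewrite {2 3}(affineK z0) Re_formZ Re_form_homogeneous mulrN opprK.
by rewrite mulrC mulKf// expf_neq0// modulus_eq0.
Qed.

End HermitianForm.

(** * Integral null vectors and elements of the Picard group *)

Section PicardGroup.
Variable R : realType.
Local Notation nm := (@Normc.normc R).
Local Notation hf := (@hermitian_form R).
Local Notation C := R[i].
Implicit Types (p g : C2 R) (z w X : 'cV[C]_3) (A B : 'M[C]_3).

Lemma gaussian_int_modulus_ge1 (a : C) :
  gaussian_int a -> a != 0 -> 1 <= nm a.
Proof.
move=> [aR aI] a0; rewrite -(expr_ge1 (n := 2))// ?modulus_ge0// modulus_sqr.
have [/eqP r0|r0] := boolP (complex.Re a == 0).
  have i0 : complex.Im a != 0.
    by apply: contra a0 => /eqP i0; rewrite eq_complex r0 i0 !eqxx.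
  by rewrite r0 expr0n add0r -real_normK ?num_real// expr_ge1// norm_intr_ge1.
rewrite -(real_normK (num_real (complex.Re a))).
by apply: ler_wpDr (sqr_ge0 _) _; rewrite expr_ge1// norm_intr_ge1.
Qed.

(** Nonzero Gaussian integer multiples are allowed, since they do not decrease the forms to be
    bounded below. *)
Definition null_vector w :=
  [/\ w != 0, forall i, gaussian_int (w i 0) & hf w w = 0].

(** These are the vectors over the cusp at infinity: isotropy reads [|w_1|^2 = 2 Re (w_0 conj w_2)],
    which vanishes. *)
Lemma null_vector0 w : null_vector w -> w 0 0 = 0 -> w 1 0 = 0 /\ w 2 0 != 0.
Proof.
move=> [w0 _ W] H0; have H1 : w 1 0 = 0.
  have := Re_hermitian_formzz w; rewrite W H0 mul0r mul0rn subr0 => /esym/eqP.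
  by rewrite expf_eq0 /= modulus_eq0 => /eqP.
split=> //; apply: contra w0 => /eqP H2.
by apply/eqP/cvec3P; rewrite ?mxE.
Qed.

Lemma picard_null_vector A w :
  picard_group A -> null_vector w -> null_vector (A *m w).
Proof.
move=> PA [w0 wZ wN]; have [B [BZ BU] BA] := picard_groupV PA.
case: PA => AZ AU; split=> [|i|]; last by rewrite AU.
  apply: contra w0 => /eqP Aw; rewrite -(mul1mx w) -BA -mulmxA Aw.
  by rewrite mulmx0.
by rewrite mxE; apply: gaussian_int_sum => k; exact: gaussian_intM.
Qed.

Definition infinity_vector : 'cV[C]_3 := delta_mx 2 0.
Local Notation eoo := infinity_vector.

Lemma infinity0 : eoo 0 0 = 0. Proof. by rewrite mxE. Qed.
Lemma infinity1 : eoo 1 0 = 0. Proof. by rewrite mxE. Qed.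
Lemma infinity2 : eoo 2 0 = 1. Proof. by rewrite mxE. Qed.
Definition infinityE := (infinity0, infinity1, infinity2).

Lemma hermitian_form_infinity z : hf z eoo = - z 0 0.
Proof.
by rewrite /hermitian_form !infinityE !(rmorph0, rmorph1); ring.
Qed.

Lemma hermitian_form_origin z : hf z (homogeneous 0) = - z 2 0.
Proof.
rewrite hermitian_form_homogeneous -[(0 : C2 R).1]/(0 : C).
by rewrite -[(0 : C2 R).2]/(0 : C) !conjc0; ring.
Qed.

Lemma null_vector_infinity : null_vector eoo.
Proof.
split=> [|i|]; last by rewrite hermitian_form_infinity infinity0 oppr0.
  by apply/eqP => /matrixP/(_ 2 0); rewrite infinity2 mxE => /eqP;
    rewrite oner_eq0.
by rewrite mxE; exact: gaussian_int_bool.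
Qed.

Lemma null_vector_homogeneous g : siegelZ g -> null_vector (homogeneous g).
Proof.
move=> [gS [g1 g2]]; split=> [|i|].
- by apply/eqP => /matrixP/(_ 0 0); rewrite homogeneous0 mxE => /eqP;
    rewrite oner_eq0.
- rewrite mxE; case: i => -[|[|[|//]]] i3 //=; exact: (gaussian_int_bool _ true).
- rewrite hermitian_form_homogeneous !homogeneousE (siegelE gS); ring.
Qed.

(** The bound [t <= |X_0|] serves the cusp at infinity, where the form is [|X_0| |w_2|] with
    [|w_2| >= 1]. The other bound, which is half the depth of [affine X] times [|X_0|], serves the
    finite cusps through [hermitian_form_ge] and [|w_0| >= 1]. *)
Lemma null_form_ge X w (t : R) : X 0 0 != 0 -> null_vector w ->
    t <= - complex.Re (hf X X) / 2 / nm (X 0 0) -> t <= nm (X 0 0) ->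
  t <= nm (hf X w).
Proof.
move=> X0 wN t1 t2; have [_ wZ W] := wN.
have [w0|w0] := eqVneq (w 0 0) 0.
  have [w1 w2] := null_vector0 wN w0.
  rewrite /hermitian_form w0 w1 !conjc0 !mulr0 sub0r subr0 normcN modulusM.
  rewrite modulusJ (le_trans t2)// ler_peMr ?modulus_ge0//.
  exact: gaussian_int_modulus_ge1.
rewrite (affineK X0) (affineK w0) hermitian_formZl hermitian_formZr !modulusM.
rewrite modulusJ.
have := hermitian_form_ge (affine X) (affine w).
rewrite (depth_affine w0) W oppr0 mul0r addr0 depth_affine// => H.
apply: (le_trans t1); have X0' : nm (X 0 0) != 0 by rewrite modulus_eq0.
rewrite -[leLHS](_ : nm (X 0 0) *
  (- complex.Re (hf X X) / nm (X 0 0) ^+ 2 / 2) = _); last first.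
  by field.
rewrite ler_wpM2l ?modulus_ge0// (le_trans H)// ler_peMl ?modulus_ge0//.
exact: gaussian_int_modulus_ge1.
Qed.

Definition translation_mx g : 'M[C]_3 := \matrix_(i, j)
  (nth [::] [:: [:: 1; 0; 0];
                [:: (g.1 : C); 1; 0];
                [:: (g.2 : C); (g.1)^*%C; 1]] i)`_j.

Lemma translationE g z :
  [/\ (translation_mx g *m z) 0 0 = z 0 0,
      (translation_mx g *m z) 1 0 = g.1 * z 0 0 + z 1 0 &
      (translation_mx g *m z) 2 0 = g.2 * z 0 0 + (g.1)^*%C * z 1 0 + z 2 0].
Proof. by split; rewrite !mxE sum_ord3 !mxE /=; ring. Qed.

(** The Gram matrix of the form is also a matrix of the Koranyi inversion, see
    [form_mx_homogeneous]. *)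
Lemma form_mxE z :
  [/\ (form_mx R *m z) 0 0 = - z 2 0, (form_mx R *m z) 1 0 = z 1 0 &
      (form_mx R *m z) 2 0 = - z 0 0].
Proof. by split; rewrite !mxE sum_ord3 !mxE /=; ring. Qed.

Lemma translation_form g z w : siegel g ->
  hf (translation_mx g *m z) (translation_mx g *m w) = hf z w.
Proof.
move=> gS; rewrite /hermitian_form; have [-> -> ->] := translationE g z.
have [-> -> ->] := translationE g w.
rewrite !(rmorphD, rmorphM) /= !conjcK.
by have E := siegelE gS; ring: E.
Qed.

Lemma translation_picard g : siegelZ g -> picard_group (translation_mx g).
Proof.
move=> [gS [g1 g2]]; split=> [i j|z w].
  rewrite mxE; case: i j => -[|[|[|//]]] ? [] [|[|[|//]]] ? //=;
  by [exact: (gaussian_int_bool _ true) | exact: (gaussian_int_bool _ false)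
     | exact: gaussian_int_conj].
exact: translation_form.
Qed.

Lemma form_mx_picard : picard_group (form_mx R).
Proof.
split=> [i j|z w].
  rewrite mxE; case: ifP => _; last apply: gaussian_intN;
  exact: gaussian_int_bool.
rewrite /hermitian_form; have [-> -> ->] := form_mxE z.
have [-> -> ->] := form_mxE w.
by rewrite !(rmorphN) /=; ring.
Qed.

Lemma translation_homogeneous g p :
  translation_mx g *m homogeneous p = homogeneous (heis_mul g p).
Proof.
have [H0 H1 H2] := translationE g (homogeneous p).
apply: cvec3P; rewrite ?(H0, H1, H2) !homogeneousE /heis_mul /=; ring.
Qed.

Lemma form_mx_homogeneous p : p.2 != 0 ->
  form_mx R *m homogeneous p = - p.2 *: homogeneous (koranyi_inv p).
Proof.
move=> p2; have [H0 H1 H2] := form_mxE (homogeneous p).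
by apply: cvec3P; rewrite ?(H0, H1, H2) [RHS]mxE !homogeneousE /=; field.
Qed.

End PicardGroup.

(** * The Heisenberg group, its integer lattice and the Dirichlet region *)

Section HeisenbergLattice.
Variable R : realType.
Local Notation nm := (@Normc.normc R).
Local Notation hf := (@hermitian_form R).
Local Notation C := R[i].
Implicit Types (p g : C2 R) (z w X : 'cV[C]_3) (K : set (C2 R)).

Lemma siegel_mul g p : siegel g -> siegel p -> siegel (heis_mul g p).
Proof.
move=> gS /siegel_depth0 p0; apply/siegel_depth0.
apply: oppr_inj; rewrite -Re_form_homogeneous -translation_homogeneous.
by rewrite translation_form// Re_form_homogeneous p0.
Qed.

Lemma siegel_inv g : siegel g -> siegel (heis_inv g).
Proof. by case: g => [[a b] [c d]]; rewrite /siegel /= !sqrrN. Qed.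

Lemma siegelZ_inv g : siegelZ g -> siegelZ (heis_inv g).
Proof.
move=> [gS [g1 g2]]; split; first exact: siegel_inv.
by split; [exact: gaussian_intN|exact: gaussian_int_conj].
Qed.

Lemma heis_invK g : heis_inv (heis_inv g) = g.
Proof. by case: g => a b; rewrite /heis_inv /= opprK conjcK. Qed.

Lemma heis_mulKg g p : siegel g -> heis_mul (heis_inv g) (heis_mul g p) = p.
Proof.
move=> /siegelE E; case: p => a b; rewrite /heis_mul /=.
by congr pair; [ring|rewrite rmorphN; ring: E].
Qed.

Lemma heis_mulVKg g p : siegel g -> heis_mul g (heis_mul (heis_inv g) p) = p.
Proof.
by move=> gS; rewrite -{1}(heis_invK g) heis_mulKg//; exact: siegel_inv.
Qed.

Lemma siegel_modulus1 p : siegel p -> nm p.1 ^+ 2 <= nm p.2 *+ 2.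
Proof. by move=> <-; rewrite lerMn2r Re_le_modulus. Qed.

Lemma siegel_neq0 p : siegel p -> p != 0 -> p.2 != 0.
Proof.
move=> pS; apply: contra => /eqP p2; have := siegel_modulus1 pS.
rewrite p2 Normc.normc0 mul0rn => p1; have {p1} : nm p.1 ^+ 2 == 0.
  by rewrite eq_le p1 sqr_ge0.
rewrite expf_eq0 /= modulus_eq0 => /eqP p1.
by apply/eqP; rewrite (surjective_pairing p) p1 p2.
Qed.

Lemma siegel_koranyi p : siegel p -> p.2 != 0 -> siegel (koranyi_inv p).
Proof.
move=> /siegel_depth0 pS p2; apply/siegel_depth0/eqP.
have [_ H] := form_mx_picard R.
have := congr1 (@complex.Re R) (H (homogeneous p) (homogeneous p)).
rewrite form_mx_homogeneous// Re_formZ !Re_form_homogeneous pS oppr0 => /eqP.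
by rewrite mulf_eq0 oppr_eq0 expf_eq0 /= modulus_eq0 oppr_eq0 (negPf p2).
Qed.

Lemma modulus_heis_mul g p :
  nm (hf (homogeneous (heis_inv g)) (homogeneous p)) = nm (heis_mul g p).2.
Proof.
rewrite -modulus_formC hermitian_form_homogeneous !homogeneousE /= conjcK.
by rewrite rmorphN -normcN; congr nm; rewrite /heis_mul /=; ring.
Qed.

(** The squared norm of the product is the modulus of a form, to which [form_triangle] centered at
    the origin applies. *)
Lemma heis_norm_mul g p : siegel g -> siegel p ->
  heis_norm (heis_mul g p) <= heis_norm g + heis_norm p.
Proof.
move=> gS pS; have S0 : siegel (0 : C2 R).
  by rewrite /siegel /= mul0rn !expr0n addr0 sqrtr0 expr0n.
have /siegel_depth0 g0 := siegel_inv gS; have /siegel_depth0 p0 := pS.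
have := @form_triangle R 0 (homogeneous (heis_inv g)) (homogeneous p) S0.
rewrite !Re_form_homogeneous p0 g0 oppr0 lexx => /(_ isT isT).
rewrite !hermitian_form_origin !homogeneousE Normc.normc1 mulr1 mul1r !normcN.
rewrite modulus_heis_mul [(heis_inv g).2]/= modulusJ.
move=> H; rewrite -(@ler_sqr R) ?nnegrE ?addr_ge0 ?sqrtr_ge0//.
by rewrite {1}/heis_norm sqr_sqrtr ?modulus_ge0.
Qed.

Lemma heis_norm_inv g : heis_norm (heis_inv g) = heis_norm g.
Proof. by rewrite /heis_norm /= modulusJ. Qed.

Lemma nearest_integer (x : R) :
  exists2 m : R, m \is a Num.int & `|x - m| <= 2^-1.
Proof.
exists (Num.floor (x + 2^-1))%:~R; first exact: intr_int.
have := floor_le (x + 2^-1); have := floorD1_gt (x + 2^-1).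
rewrite ler_norml intrD => H1 H2; lra.
Qed.

(** First coordinates of lattice points lie in [(1 + i) Z[i]], since [|a|^2 = 2 Re b] is even.
    Rounding along the axes of this sublattice gives [|u| <= 1], so [Re v <= 1/2]; the imaginary
    part of [b] is a free integer, which gives [|Im v| <= 1/2]. Hence [|v|^2 <= 1/2 < 9/16]. *)
Lemma siegelZ_reduction p : siegel p ->
  exists2 g, siegelZ g & nm (heis_mul g p).2 <= 3 / 4.
Proof.
move=> pS; pose x := complex.Re p.1; pose y := complex.Im p.1.
have [m mZ Hm] := nearest_integer ((x + y) / 2).
have [n nZ Hn] := nearest_integer ((y - x) / 2).
pose a : C := (n - m) +i* (- (m + n)).
pose b0 : C := (m ^+ 2 + n ^+ 2) +i* 0.
have [k kZ Hk] := nearest_integer (complex.Im (p.2 + b0 + a^*%C * p.1)).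
pose b : C := (m ^+ 2 + n ^+ 2) +i* (- k).
have gS : siegel ((a, b) : C2 R).
  by rewrite /siegel /= sqr_sqrtr ?addr_ge0 ?sqr_ge0//; ring.
exists (a, b).
  split=> //; split; split; rewrite /= ?rpredN ?rpredB ?rpredD//;
  by rewrite expr2 rpredM.
have hS := siegel_mul gS pS; set q := heis_mul (a, b) p in hS *.
have q1 : nm q.1 ^+ 2 <= 1.
  rewrite modulus_sqr; move: Hm Hn; rewrite /q /x /y /a /=.
  case: p.1 => [u1 u2] /=; rewrite !ler_norml => /andP[h1 h2] /andP[h3 h4].
  set s := (u1 + u2) / 2 - m in h1 h2; set t := (u2 - u1) / 2 - n in h3 h4.
  have -> : (n - m + u1) ^+ 2 + (- (m + n) + u2) ^+ 2 = (s ^+ 2 + t ^+ 2) *+ 2.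
    by rewrite /s /t; field.
  by nra.
have q2 : `|complex.Im q.2| <= 2^-1.
  suff -> : complex.Im q.2 = complex.Im (p.2 + b0 + a^*%C * p.1) - k by [].
  by rewrite /q /heis_mul /b0 /b /=; case: p.1 p.2 => [? ?] [? ?] /=; ring.
move: hS; rewrite /siegel /= => hS.
rewrite -ler_sqr ?nnegrE ?modulus_ge0//.
rewrite modulus_sqr; move: q1 q2; rewrite -hS.
set r := complex.Re _; set t := complex.Im _ => r1; rewrite ler_norml.
have r0 : 0 <= r by have := sqr_ge0 (nm q.1); rewrite -hS; lra.
by move=> /andP[t1 t2]; nra.
Qed.

(** By the reduction some lattice point is this close to [p], and for [p] in [K] the origin is at
    least as close. *)
Lemma dirichlet_modulus K p : dirichlet_region K -> K p ->
  siegel p /\ nm p.2 <= 3 / 4.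
Proof.
move=> [_ KD _] /KD [pS pmin]; split=> //.
have [g gZ Hg] := siegelZ_reduction pS.
have [gS _] := gZ.
have [g0|g0] := eqVneq (heis_inv g) 0.
  move: Hg; rewrite -(heis_invK g) g0 /heis_mul /=.
  by rewrite !(rmorph0, conjc0, oppr0, mul0r, add0r, addr0).
have := pmin _ (siegelZ_inv gZ) g0.
rewrite /heis_dist /heis_norm ler_sqrt ?modulus_ge0// => H.
have E0 : nm (heis_mul (heis_inv p) 0).2 = nm p.2.
  by rewrite /heis_mul /= mulr0 !addr0 modulusJ.
have Eg : nm (heis_mul (heis_inv p) (heis_inv g)).2 = nm (heis_mul g p).2.
  rewrite -modulusJ; congr nm; rewrite /heis_mul /=.
  by rewrite !(rmorphD, rmorphM, rmorphN) /= !conjcK; ring.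
by rewrite -E0 (le_trans H)// Eg.
Qed.

Lemma nearest_intP K p : dirichlet_region K -> siegel p ->
  [/\ siegelZ (nearest_int K p), K (frac_part K p) &
      heis_mul (nearest_int K p) (frac_part K p) = p].
Proof.
move=> [_ _ [cov _ _]] pS.
have [gZ Kg] : [set g | siegelZ g /\ (heis_mul g @` K) p] (nearest_int K p).
  (* The translates of [K] cover, so the default value 0 of [nearest_int] does not arise here. *)
  apply: xgetPex; move: pS; rewrite -cov => -[g gZ Kg]; by exists g.
have gS := gZ.1; split=> //; last by rewrite heis_mulVKg.
by case: Kg => k Kk kp; rewrite /frac_part -{2}kp heis_mulKg.
Qed.

End HeisenbergLattice.

(** * Bad approximability in terms of null vectors *)

Section Approximation.
Variable R : realType.
Local Notation nm := (@Normc.normc R).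
Local Notation hf := (@hermitian_form R).
Local Notation C := R[i].
Implicit Types (h y p g : C2 R) (z w X : 'cV[C]_3).

Lemma rational_int (x : R) : x \is a Num.int -> range (@ratr R) x.
Proof. by move=> /intrP[m ->]; exists m%:~R => //; rewrite ratr_int. Qed.

Lemma gaussian_int_rat (a : C) : gaussian_int a -> gaussian_rat a.
Proof. by move=> [aR aI]; split; exact: rational_int. Qed.

Lemma gaussian_ratM (a b : C) :
  gaussian_rat a -> gaussian_rat b -> gaussian_rat (a * b).
Proof.
case: a b => [a a'] [b b'] [/= [x _ <-] [x' _ <-]] [/= [y _ <-] [y' _ <-]].
split=> /=; first by exists (x * y - x' * y') => //; rewrite rmorphB !rmorphM.
by exists (x * y' + x' * y) => //; rewrite rmorphD !rmorphM.
Qed.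

Lemma gaussian_ratV (a : C) : gaussian_rat a -> gaussian_rat a^-1.
Proof.
case: a => [a a'] [/= [x _ <-] [x' _ <-]]; split=> /=.
  by exists (x / (x ^+ 2 + x' ^+ 2)) => //; rewrite fmorph_div rmorphD !rmorphXn.
exists (- (x' / (x ^+ 2 + x' ^+ 2))) => //.
by rewrite rmorphN fmorph_div rmorphD !rmorphXn.
Qed.

Lemma rational_denominator (x : R) : range (@ratr R) x ->
  exists2 d : R, d \is a Num.int /\ d != 0 & x * d \is a Num.int.
Proof.
move=> [r _ <-]; have d0 : (denq r)%:~R != 0 :> R by rewrite intr_eq0 denq_neq0.
exists (denq r)%:~R; first by split=> //; exact: intr_int.
by rewrite /ratr divfK// intr_int.
Qed.

(** The product of the denominators of the four real coordinates serves. *)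
Lemma is_denominator_ex y : siegelQ y -> exists q, is_denominator y q.
Proof.
case: y => [[a a'] [b b']] [_ [[/= Ha Ha'] [/= Hb Hb']]].
have [d1 [d1Z d10] ad] := rational_denominator Ha.
have [d2 [d2Z d20] a'd] := rational_denominator Ha'.
have [d3 [d3Z d30] bd] := rational_denominator Hb.
have [d4 [d4Z d40] b'd] := rational_denominator Hb'.
pose d := d1 * d2 * d3 * d4.
have d0 : d != 0 by rewrite !mulf_neq0.
have qZ : gaussian_int (d +i* 0) by split; rewrite /= ?rpred0 ?rpredM.
have q0 : (d +i* 0 : C) != 0 by rewrite eq_complex /= (negPf d0).
exists (d +i* 0); split=> //.
exists ((a +i* a') * (d +i* 0)), ((b +i* b') * (d +i* 0)); split.
- split; rewrite /= ?(mulr0, subr0, add0r).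
    have -> : a * d = a * d1 * (d2 * d3 * d4) by rewrite /d; ring.
    by apply: rpredM; last rewrite !rpredM.
  have -> : a' * d = a' * d2 * (d1 * d3 * d4) by rewrite /d; ring.
  by apply: rpredM; last rewrite !rpredM.
- split; rewrite /= ?(mulr0, subr0, add0r).
    have -> : b * d = b * d3 * (d1 * d2 * d4) by rewrite /d; ring.
    by apply: rpredM; last rewrite !rpredM.
  have -> : b' * d = b' * d4 * (d1 * d2 * d3) by rewrite /d; ring.
  by apply: rpredM; last rewrite !rpredM.
- by rewrite !mulfK.
Qed.

Lemma denominator_has_lbound y :
  has_lbound [set nm q | q in is_denominator y].
Proof. by exists 0 => _ [q _ <-]; exact: modulus_ge0. Qed.

Lemma siegel_height_ge1 y : siegelQ y -> 1 <= siegel_height y.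
Proof.
move=> yQ; have [q yq] := is_denominator_ex yQ.
apply: lb_le_inf; first by exists (nm q), q.
by move=> _ [q' [q'Z q'0 _] <-]; exact: gaussian_int_modulus_ge1.
Qed.

Lemma modulus_form_dist (q : C) h y :
  nm (hf (q *: homogeneous y) (homogeneous h)) = nm q * heis_dist h y ^+ 2.
Proof.
rewrite hermitian_formZl modulusM modulus_formC /heis_dist /heis_norm.
by rewrite sqr_sqrtr ?modulus_ge0// -modulus_heis_mul heis_invK.
Qed.

Lemma affine_siegel w : null_vector w -> w 0 0 != 0 -> siegel (affine w).
Proof.
move=> [_ _ W] w0; apply/siegel_depth0.
by rewrite depth_affine// W oppr0 mul0r.
Qed.

(* The same condition phrased with integral null vectors instead of rational
   points: [d(h, r/q, p/q)^2 |q|^2 = |<(q, r, p), h>| |q|]. *)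
Definition null_gap h (c : R) := forall w, null_vector w -> w 0 0 != 0 ->
  c <= nm (hf w (homogeneous h)) * nm (w 0 0).

Lemma badly_approximableP h :
  badly_approximable h <-> exists2 c : R, 0 < c & null_gap h c.
Proof.
split=> [[c c0 Hc]|[c c0 Hc]].
  (* The form is quadratic in the distance, hence the square; [w 0 0] is one of the denominators
     over which the height is the infimum. *)
  exists (c ^+ 2) => [|w wN w0]; first exact: exprn_gt0.
  have [_ wZ W] := wN; have yS := affine_siegel wN w0.
  have yQ : siegelQ (affine w).
    split=> //; split; apply: gaussian_ratM; try apply: gaussian_ratV;
    exact: gaussian_int_rat.
  have hy := siegel_height_ge1 yQ.
  have {Hc} := Hc _ yQ; rewrite ltr_pdivrMr ?(lt_le_trans _ hy)// => Hc.
  rewrite {1}(affineK w0) modulus_form_dist mulrAC -expr2 mulrC -exprMn.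
  rewrite ler_sqr ?nnegrE ?mulr_ge0 ?modulus_ge0 ?sqrtr_ge0 ?(ltW c0)//.
  rewrite (le_trans (ltW Hc))// ler_wpM2l ?sqrtr_ge0//.
  apply: ge_inf; first exact: denominator_has_lbound.
  exists (w 0 0) => //; split=> //.
  by exists (w 1 0), (w 2 0).
(* Halving the constant turns the weak inequality into the strict one required. *)
exists (Num.sqrt c / 2) => [|y yQ]; first by rewrite divr_gt0// sqrtr_gt0.
have key q : is_denominator y q -> Num.sqrt c <= nm q * heis_dist h y.
  move=> [qZ q0 [r [p [rZ pZ yE]]]].
  have [yS _] := yQ; move/siegel_depth0 : yS => y0.
  have HE : q *: homogeneous y = \col_i [:: q; r; p]`_i.
    apply: cvec3P; rewrite !mxE yE /= ?mulr1//.
      by rewrite mulrC divfK.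
    by rewrite mulrC divfK.
  have wN : null_vector (q *: homogeneous y).
    split=> [|i|].
    - by apply/eqP => /matrixP/(_ 0 0)/eqP; rewrite !mxE mulr1 (negPf q0).
    - by rewrite HE mxE; case: i => -[|[|[|//]]].
    rewrite hermitian_formZl hermitian_formZr hermitian_form_homogeneous.
    by rewrite !homogeneousE (siegelE yQ.1); ring.
  have := Hc _ wN; rewrite modulus_form_dist !mxE mulr1 => /(_ q0).
  rewrite mulrAC -expr2 -exprMn => H.
  rewrite -ler_sqr ?nnegrE ?mulr_ge0 ?sqrtr_ge0 ?modulus_ge0//.
  by rewrite sqr_sqrtr// ltW.
have [q0 yq0] := is_denominator_ex yQ.
have d0 : 0 < heis_dist h y.
  rewrite lt_def sqrtr_ge0 andbT; apply/eqP => d0; have := key _ yq0.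
  by rewrite d0 mulr0 leNgt sqrtr_gt0 c0.
have ht0 := lt_le_trans ltr01 (siegel_height_ge1 yQ).
rewrite ltr_pdivrMr//; apply: (@lt_le_trans _ _ (Num.sqrt c)).
  by rewrite ltr_pdivrMr// ltr_pMr ?sqrtr_gt0// ltr1n.
rewrite mulrC -ler_pdivrMr//; apply: lb_le_inf; first by exists (nm q0), q0.
by move=> _ [q yq <-]; rewrite ler_pdivrMr//; exact: key.
Qed.

End Approximation.

(** * Forms along the vertical ray *)

Section VerticalRay.
Variable R : realType.
Local Notation nm := (@Normc.normc R).
Local Notation hf := (@hermitian_form R).
Local Notation C := R[i].
Local Notation eoo := (infinity_vector R).
Implicit Types (h y p g : C2 R) (z w X : 'cV[C]_3).

Definition vertical h (s : R) : C2 R := (h.1, h.2 + s%:C).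

Lemma homogeneous_vertical h s :
  homogeneous (vertical h s) = homogeneous h + s%:C *: eoo.
Proof.
by apply: cvec3P; rewrite !mxE /= ?(mulr0, mulr1, addr0).
Qed.

Lemma depth_vertical h s : siegel h -> depth (vertical h s) = s *+ 2.
Proof.
rewrite /siegel /depth /= => <-.
by case: h => [h1 [a b]] /=; rewrite mulrnDl addrAC subrr add0r.
Qed.

Lemma form_vertical h s w :
  hf (homogeneous (vertical h s)) w = hf (homogeneous h) w - s%:C * (w 0 0)^*%C.
Proof.
rewrite homogeneous_vertical hermitian_formDl hermitian_formZl; congr (_ + _).
by rewrite -mulrN hermitian_formC hermitian_form_infinity rmorphN.
Qed.

Lemma form_vertical_le h s w : 0 <= s ->
  nm (hf (homogeneous (vertical h s)) w) <=
  s * nm (w 0 0) + nm (hf w (homogeneous h)).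
Proof.
move=> s0; rewrite form_vertical (le_trans (modulusB _ _))// addrC.
by rewrite modulusM modulusJ modulus_real// -modulus_formC.
Qed.

Lemma form_le_vertical h s w : 0 <= s ->
  nm (hf w (homogeneous h)) <=
  nm (hf (homogeneous (vertical h s)) w) + s * nm (w 0 0).
Proof.
move=> s0; rewrite -modulus_formC -{1}[hf _ w](subrK (s%:C * (w 0 0)^*%C)).
rewrite -form_vertical (le_trans (modulusD _ _))// modulusM modulusJ.
by rewrite modulus_real.
Qed.

(** Let [F] be the modulus of the form at height [s]. For a finite cusp, [s |w_0| <= F] by the depth
    estimate, so [|<w, h>| <= F + s |w_0| <= 2 F]; multiplying gives [s c <= 2 F^2]. The 1 in the
    minimum covers the cusp at infinity. *)
Lemma vertical_gap h c : siegel h -> 0 < c -> null_gap h c ->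
  exists2 e : R, 0 < e & forall s w, 0 < s -> s <= 1 -> null_vector w ->
    e * s <= nm (hf (homogeneous (vertical h s)) w) ^+ 2.
Proof.
move=> hS c0 Hc; exists (Num.min 1 (c / 2)) => [|s w s0 s1 wN].
  by rewrite lt_min ltr01 divr_gt0.
have [w0|w0] := eqVneq (w 0 0) 0.
  have [w1 w2] := null_vector0 wN w0.
  rewrite form_vertical w0 conjc0 mulr0 subr0 -modulus_formC.
  rewrite hermitian_form_homogeneous w0 w1 !mul0r !sub0r oppr0 add0r normcN.
  apply: (@le_trans _ _ 1).
    apply: (le_trans _ s1); rewrite -[leRHS]mul1r ler_wpM2r ?(ltW s0)//.
    by rewrite ge_min lexx.
  by rewrite expr_ge1 ?modulus_ge0// gaussian_int_modulus_ge1//; case: wN.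
set F := nm (hf _ w).
have F1 : s * nm (w 0 0) <= F.
  rewrite /F {2}(affineK w0) hermitian_formZr modulusM modulusJ mulrC.
  rewrite ler_wpM2l ?modulus_ge0//.
  have := hermitian_form_ge (vertical h s) (affine w).
  have /siegel_depth0 -> := affine_siegel wN w0.
  by rewrite addr0 depth_vertical// -[s *+ 2]mulr_natr mulfK.
have F2 : nm (hf w (homogeneous h)) <= F *+ 2.
  by rewrite (le_trans (form_le_vertical _ _ (ltW s0)))// mulr2n lerD2l.
have := Hc _ wN w0.
set E := nm (hf w _) in F2 *; set N := nm (w 0 0) in F1 *.
have E0 : 0 <= E by exact: modulus_ge0.
have N0 : 0 <= N by exact: modulus_ge0.
move=> cE; apply: (@le_trans _ _ (c / 2 * s)).
  by rewrite ler_wpM2r ?(ltW s0)// ge_min lexx orbT.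
have : (s * N) * E <= F * (F *+ 2) by rewrite ler_pM// mulr_ge0// ltW.
have : s * c <= s * (E * N) by rewrite ler_wpM2l// ltW.
by move: F E N {F1 F2 E0 N0 cE} => F E N; rewrite expr2 => h1 h2; nra.
Qed.

(* Taking [s = c / |q|^2] for a rational point of denominator [q] violating the
   gap [c] makes the form at the corresponding point of the ray too small. *)
Lemma approach_gap h (e s0 B : R) : 0 < e -> 0 < s0 -> 0 < B ->
    (forall s, 0 < s -> s <= s0 -> exists2 X,
      forall w, null_vector w -> e * s <= nm (hf X w) ^+ 2 &
      forall w, null_vector w ->
        nm (hf X w) <= B * (s * nm (w 0 0) + nm (hf w (homogeneous h)))) ->
  exists2 c, 0 < c & null_gap h c.
Proof.
(* The first bound keeps [s] below [s0]. The second makes [4 B^2 c <= e / 2], against the inequality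
   [e <= 4 B^2 c] that a violation of the gap would give. *)
move=> e0 s00 B0 H; pose c := Num.min s0 (e / (8 * B ^+ 2)).
have c0 : 0 < c by rewrite lt_min s00 divr_gt0// mulr_gt0// exprn_gt0.
exists c => // w wN w0; rewrite leNgt; apply/negP.
set E := nm (hf w _); set N := nm (w 0 0) => EN.
have N1 : 1 <= N by apply: gaussian_int_modulus_ge1 => //; case: wN.
have N0 : 0 < N := lt_le_trans ltr01 N1.
pose s := c / N ^+ 2.
have sp : 0 < s by rewrite divr_gt0// exprn_gt0.
have ss0 : s <= s0.
  rewrite ler_pdivrMr ?exprn_gt0// (le_trans (_ : c <= s0))//.
    by rewrite ge_min lexx.
  by rewrite ler_peMr ?(ltW s00)// expr_ge1// ltW.
have [X X1 X2] := H _ sp ss0.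
have sN : E <= s * N.
  by rewrite /s expr2 invfM mulrA mulfVK ?gt_eqF// ler_pdivlMr// ltW.
have F : nm (hf X w) <= B * (s * N *+ 2).
  by rewrite (le_trans (X2 _ wN))// ler_wpM2l ?(ltW B0)// mulr2n lerD2l.
have : e * s <= (B * (s * N *+ 2)) ^+ 2.
  rewrite (le_trans (X1 _ wN))// ler_sqr ?nnegrE ?modulus_ge0//.
  exact: le_trans (modulus_ge0 _) F.
have -> : (B * (s * N *+ 2)) ^+ 2 = 4 * B ^+ 2 * c * s.
  have -> : c = s * N ^+ 2 by rewrite /s divfK// expf_neq0// gt_eqF.
  by ring.
rewrite ler_pM2r//; apply/negP; rewrite -ltNge.
apply: (@le_lt_trans _ _ (4 * B ^+ 2 * (e / (8 * B ^+ 2)))).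
  by apply: ler_wpM2l; [exact: mulr_ge0 (sqr_ge0 _)|rewrite /c ge_min lexx orbT].
rewrite (_ : _ * _ = e / 2); first lra.
by field; rewrite gt_eqF.
Qed.

End VerticalRay.

(** * Convergents and remainders of the continued fraction *)

Section ContinuedFractions.
Variable R : realType.
Local Notation nm := (@Normc.normc R).
Local Notation hf := (@hermitian_form R).
Local Notation C := R[i].
Local Notation eoo := (infinity_vector R).
Implicit Types (h y p g : C2 R) (z w X : 'cV[C]_3) (A : 'M[C]_3).
Variable K : set (C2 R).
Hypothesis hK : dirichlet_region K.
Variable h : C2 R.
Hypothesis hS : siegel h.
Local Notation rem := (cf_remainder K h).

Lemma remainderP n : siegel (rem n) /\ nm (rem n).2 <= 3 / 4.
Proof.
elim: n => [|n [IH _]].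
  by have [_ /(dirichlet_modulus hK)] := nearest_intP hK hS.
rewrite /cf_remainder iterS -/(rem n) /gauss_map; case: eqVneq => [_|r0].
  split; first by rewrite /siegel /= mul0rn !expr0n addr0 sqrtr0 expr0n.
  by rewrite Normc.normc0 divr_ge0.
have rS := siegel_koranyi IH (siegel_neq0 IH r0).
by have [_ /(dirichlet_modulus hK)] := nearest_intP hK rS.
Qed.

(** This is the modulus of the factor [l_n] by which the image of [h] differs from its [n]-th
    remainder, as [cf_matrix] shows. *)
Definition cf_scale n : R := \prod_(i < n) nm (rem i).2.

Lemma cf_scaleS n : cf_scale n.+1 = cf_scale n * nm (rem n).2.
Proof. by rewrite /cf_scale big_ord_recr. Qed.

Lemma cf_scale_ge0 n : 0 <= cf_scale n.
Proof. by apply: prodr_ge0 => i _; exact: modulus_ge0. Qed.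

Lemma cf_scale_le n : cf_scale n <= (3 / 4) ^+ n.
Proof.
elim: n => [|n IH]; first by rewrite /cf_scale big_ord0.
rewrite cf_scaleS exprSr ler_pM ?modulus_ge0 ?cf_scale_ge0//.
by have [] := remainderP n.
Qed.

(* [A] is the inverse of the matrix of the convergent: it maps [h] to its
   remainder, and its inverse maps infinity to the convergent, whose denominator
   is [(A eoo) 0 0] up to conjugation. *)
Lemma next_denominator_le A l p : siegel p -> nm p.2 <= 3 / 4 ->
    picard_group A -> A *m homogeneous h = l *: homogeneous p ->
    nm ((A *m eoo) 0 0) * nm l <= 12 ->
  nm ((A *m eoo) 2 0) * nm l <= 16.
Proof.
move=> pS p34 [AZ AU] Al; set z := A *m eoo => z12.
(* [A] preserves the form, and the form of [eoo] and [h] has modulus 1. *)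
have zh : nm (hf z (homogeneous p)) * nm l = 1.
  have := congr1 nm (AU eoo (homogeneous h)).
  rewrite Al hermitian_formZr modulusM modulusJ mulrC => ->.
  rewrite -modulus_formC hermitian_form_infinity homogeneous0 normcN.
  exact: Normc.normc1.
have S0 : siegel (0 : C2 R).
  by rewrite /siegel /= mul0rn !expr0n addr0 sqrtr0 expr0n.
have := form_triangle (X := homogeneous 0) (w := z) pS.
rewrite Re_form_homogeneous; have /siegel_depth0 -> := S0.
rewrite oppr0 lexx AU hermitian_form_infinity infinity0 oppr0 /= lexx.
move=> /(_ isT isT); rewrite homogeneous0 Normc.normc1 mul1r.
rewrite -modulus_formC hermitian_form_origin normcN.
rewrite -modulus_formC hermitian_form_origin normcN homogeneous2 => H.
have l0 : 0 <= nm l by exact: modulus_ge0.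
apply: (le_trans (ler_wpM2r l0 H)).
rewrite -[in leLHS](sqr_sqrtr l0) -exprMn mulrDl.
rewrite -!sqrtrM ?mulr_ge0 ?modulus_ge0//.
(* The constants reproduce themselves: [(sqrt (12 * 3/4) + 1)^2 = 16], and [16 * 3/4 = 12] in
   [cf_matrix]. *)
rewrite zh sqrtr1 -[leRHS](_ : (3 + 1) ^+ 2 = 16); last by ring.
rewrite ler_sqr ?nnegrE ?addr_ge0 ?sqrtr_ge0// lerD2r.
rewrite -[leRHS]ger0_norm// -sqrtr_sqr ler_sqrt ?sqr_ge0// -mulrA.
apply: (le_trans (ler_pM _ _ p34 z12)); rewrite ?mulr_ge0 ?modulus_ge0//; lra.
Qed.

(** Each step composes with the inversion and a lattice translation. The inversion brings the last
    coordinate of [A *m eoo] to the front, where [next_denominator_le] bounds it, and the scale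
    gains the factor [|v_n| <= 3/4]. *)
Lemma cf_matrix n : (forall i, (i < n)%N -> rem i != 0) ->
  exists A l, [/\ picard_group A, A *m homogeneous h = l *: homogeneous (rem n),
    nm l = cf_scale n & nm ((A *m eoo) 0 0) * nm l <= 12].
Proof.
elim: n => [_|n IH r0].
  have [gZ _ _] := nearest_intP hK hS.
  exists (translation_mx (heis_inv (nearest_int K h))), 1.
  split.
  - exact/translation_picard/siegelZ_inv.
  - by rewrite translation_homogeneous scale1r.
  - by rewrite Normc.normc1 /cf_scale big_ord0.
  - by have [-> _ _] := translationE (heis_inv (nearest_int K h)) eoo;
      rewrite infinity0 Normc.normc0 mul0r.
have [i ilt|A [l [AP Al lE Ale]]] := IH; first by apply: r0; exact: ltnW.
have [pS p34] := remainderP n; have rn0 := r0 n (ltnSn n).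
have p20 := siegel_neq0 pS rn0.
have rS := siegel_koranyi pS p20.
have [gZ _ _] := nearest_intP hK rS.
set g := nearest_int K _ in gZ.
have H16 := next_denominator_le pS p34 AP Al Ale.
exists (translation_mx (heis_inv g) *m (form_mx R *m A)), (- (l * (rem n).2)).
split.
- apply: picard_groupM; first exact/translation_picard/siegelZ_inv.
  by apply: picard_groupM => //; exact: form_mx_picard.
- rewrite -!mulmxA Al -scalemxAr form_mx_homogeneous// -!scalemxAr.
  rewrite translation_homogeneous scalerA mulrN; congr (_ *: homogeneous _).
  by rewrite /cf_remainder iterS -/(rem n) /gauss_map (negPf rn0).
- by rewrite normcN modulusM lE cf_scaleS.
rewrite -!mulmxA.
have [-> _ _] := translationE (heis_inv g) (form_mx R *m (A *m eoo)).
have [-> _ _] := form_mxE (A *m eoo).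
rewrite !normcN modulusM mulrA (_ : 12 = 16 * (3 / 4)); last by field.
by rewrite ler_pM ?mulr_ge0 ?modulus_ge0.
Qed.

Lemma cf_scale_gt0 n : (forall i, (i < n)%N -> rem i != 0) ->
  0 < cf_scale n.
Proof.
move=> r0; apply: prodr_gt0 => i _; rewrite modulus_gt0.
by apply: siegel_neq0; [case: (remainderP i)|exact: r0].
Qed.

(* The next convergent is the image of the origin, and it approximates [h] to
   the order [|v_n| / |q|^2]. *)
Lemma gap_remainder c : 0 < c -> null_gap h c ->
  forall n, c / 16 <= nm (rem n).2.
Proof.
move=> c0 Hc; elim/ltn_ind => n IH.
(* Strong induction ensures that the expansion has not ended before [n], as [cf_matrix] requires. *)
have r0 i : (i < n)%N -> rem i != 0.
  move=> /IH; apply: contraTneq => ->.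
  by rewrite Normc.normc0 -ltNge divr_gt0.
have [A [l [AP Al lE Ale]]] := cf_matrix r0.
have [pS p34] := remainderP n.
have H16 := next_denominator_le pS p34 AP Al Ale.
have [B BP BA] := picard_groupV AP; have AB := mulmx1C BA.
have S0 : siegelZ (0 : C2 R).
  split; first by rewrite /siegel /= mul0rn !expr0n addr0 sqrtr0 expr0n.
  by split; exact: (gaussian_int_bool _ false).
pose w := B *m homogeneous (0 : C2 R).
have wN : null_vector w by exact/picard_null_vector/null_vector_homogeneous.
have Aw : A *m w = homogeneous 0 by rewrite mulmxA AB mul1mx.
have [_ AU] := AP.
have Ew : nm (hf w (homogeneous h)) = nm l * nm (rem n).2.
  rewrite -AU Aw Al hermitian_formZr modulusM modulusJ -modulus_formC.
  by rewrite hermitian_form_origin normcN homogeneous2.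
have Ew0 : nm (w 0 0) = nm ((A *m eoo) 2 0).
  rewrite -normcN -hermitian_form_infinity -AU Aw -modulus_formC.
  by rewrite hermitian_form_origin normcN.
(* This convergent is not infinity: otherwise the form would be [|w_2| >= 1], while it equals
   [|l| |v_n| <= 3/4]. *)
have [w0|w0] := eqVneq (w 0 0) 0.
  have [w1 w2] := null_vector0 wN w0.
  have wZ : gaussian_int (w 2 0) by case: wN.
  have := gaussian_int_modulus_ge1 wZ w2.
  have <- : nm (hf w (homogeneous h)) = nm (w 2 0).
    by rewrite hermitian_form_homogeneous w0 w1 !mul0r !sub0r oppr0 add0r normcN.
  rewrite Ew lE => /le_trans/(_ (ler_wpM2l (cf_scale_ge0 n) p34)).
  have := cf_scale_le n; have : (3 / 4 : R) ^+ n <= 1.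
    by rewrite exprn_ile1//; lra.
  lra.
have := Hc _ wN w0; rewrite Ew Ew0 => H.
rewrite ler_pdivrMr// (le_trans H)// mulrAC mulrC ler_wpM2l ?modulus_ge0//.
by rewrite mulrC.
Qed.

End ContinuedFractions.

(** * Bounded digits and the gap *)

Section BoundedDigits.
Variable R : realType.
Local Notation nm := (@Normc.normc R).
Local Notation hf := (@hermitian_form R).
Local Notation C := R[i].
Local Notation eoo := (infinity_vector R).
Implicit Types (p g : C2 R) (z w X : 'cV[C]_3) (A : 'M[C]_3).

Lemma heis_mulgK g p : siegel p -> heis_mul (heis_mul g p) (heis_inv p) = g.
Proof.
move=> /siegelE E; case: g => a b; rewrite /heis_mul /=.
by congr pair; [ring|rewrite rmorphD; ring: E].
Qed.

Lemma heis_norm_le1 p : nm p.2 <= 3 / 4 -> heis_norm p <= 1.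
Proof.
move=> p34; rewrite /heis_norm -[leRHS]sqrtr1 ler_sqrt// (le_trans p34)//; lra.
Qed.

Lemma heis_norm_koranyi p : heis_norm (koranyi_inv p) = Num.sqrt (nm p.2)^-1.
Proof. by rewrite /heis_norm /= mul1r modulusV. Qed.

Lemma geometric_lt (x e : R) : 0 <= x -> x < 1 -> 0 < e ->
  exists n, x ^+ n < e.
Proof.
move=> x0 x1 e0; have : (fun n => x ^+ n) @ \oo --> (0 : R).
  by apply: cvg_expr; rewrite ger0_norm.
move=> /cvgr0_norm_lt/(_ _ e0)[N _ /(_ N (leqnn N))] /=.
by rewrite ger0_norm ?exprn_ge0//; exists N.
Qed.

Variables (K : set (C2 R)) (h : C2 R).
Hypotheses (hK : dirichlet_region K) (hS : siegel h).
Local Notation rem := (cf_remainder K h).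

Lemma digitP n : rem n != 0 ->
  let g := nearest_int K (koranyi_inv (rem n)) in
  [/\ siegel g, siegel (koranyi_inv (rem n)) &
      heis_mul g (rem n.+1) = koranyi_inv (rem n)].
Proof.
move=> r0; have [pS _] := remainderP hK hS n.
have rS := siegel_koranyi pS (siegel_neq0 pS r0).
have [[gS _] _ E] := nearest_intP hK rS; split=> //.
rewrite /cf_remainder iterS -/(rem n) /gauss_map (negPf r0).
exact: E.
Qed.

(** A digit is the inverted remainder, of norm [|v_n|^(-1/2)], times the inverse of the next
    remainder, of norm at most 1. *)
Lemma gap_bounded_digits c : 0 < c -> null_gap h c -> bounded_digits K h.
Proof.
move=> c0 Hc; have v0 := gap_remainder hK hS c0 Hc.
(* The first summand serves the digit of index 0, the others the later digits. *)
exists (heis_norm (nearest_int K h) + (Num.sqrt (c / 16)^-1 + 1)).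
case=> [|n] /=.
  by exists (nearest_int K h) => //; rewrite lerDl addr_ge0 ?sqrtr_ge0.
have r0 : rem n != 0.
  apply: contraTneq (v0 n) => ->.
  by rewrite Normc.normc0 -ltNge divr_gt0.
rewrite (negPf r0); eexists; first by [].
have [gS kS E] := digitP r0; have [pS p34] := remainderP hK hS n.+1.
rewrite -(heis_mulgK (nearest_int K (koranyi_inv (rem n))) pS) E.
apply: (le_trans (heis_norm_mul _ (siegel_inv pS))) => //.
apply: ler_wpDl; first exact: sqrtr_ge0.
rewrite heis_norm_inv lerD ?heis_norm_le1// heis_norm_koranyi.
by rewrite ler_sqrt ?invr_ge0 ?divr_ge0 ?(ltW c0)// lef_pV2 ?posrE ?divr_gt0//
  (lt_le_trans _ (v0 n)) ?divr_gt0.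
Qed.

(** Since all digits exist, no remainder vanishes; then [|v_n|^(-1/2)] is at most the norm of the
    digit plus that of the next remainder. *)
Lemma bounded_digits_remainder : bounded_digits K h ->
  exists2 e : R, 0 < e & forall n, e <= nm (rem n).2.
Proof.
move=> [M HM].
have r0 n : rem n != 0.
  by have [g] := HM n.+1; rewrite /=; case: eqP.
have [g0 _ M0] := HM 0%N; have {}M0 := le_trans (sqrtr_ge0 _) M0.
have M1 : 0 < M + 1 by lra.
exists ((M + 1) ^+ 2)^-1 => [|n]; first by rewrite invr_gt0 exprn_gt0.
have [gS kS E] := digitP (r0 n); have [pS p34] := remainderP hK hS n.+1.
have [qS _] := remainderP hK hS n.
have q2 : 0 < nm (rem n).2 by rewrite modulus_gt0 siegel_neq0.
have : heis_norm (koranyi_inv (rem n)) <= M + 1.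
  rewrite -E (le_trans (heis_norm_mul gS pS))// lerD ?heis_norm_le1//.
  by have [g /=] := HM n.+1; rewrite (negPf (r0 n)) => -[<-].
rewrite heis_norm_koranyi -ler_sqr ?nnegrE ?sqrtr_ge0 ?(ltW M1)//.
rewrite sqr_sqrtr ?invr_ge0 ?modulus_ge0// => H.
by rewrite -[leRHS]invrK lef_pV2 ?posrE ?invr_gt0 ?exprn_gt0.
Qed.

(* The scales [L_n^2 / 24] cover a neighbourhood of [0] up to bounded factors,
   and the matrix of the [n]-th convergent moves the point of the vertical ray at
   such a scale to a point of bounded depth, far from all the cusps. *)
Lemma bounded_digits_gap : bounded_digits K h ->
  exists2 c, 0 < c & null_gap h c.
Proof.
move=> /bounded_digits_remainder [e e0 He].
have r0 n : rem n != 0.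
  apply: contraTneq (He n) => ->.
  by rewrite Normc.normc0 -ltNge.
have e1 : e <= 1.
  by have [_ ?] := remainderP hK hS 0%N; have := He 0%N; lra.
(* As [36^2 = 54 * 24], the bound [e^2 L / 36] on the form, reached at the end, has square
   [e^4 / 54 * (L^2 / 24)], where [L^2 / 24 >= s]. *)
apply: (@approach_gap R h (e ^+ 4 / 54) 24^-1 1) => //.
  by rewrite divr_gt0// exprn_gt0.
move=> s sp s1; exists (homogeneous (vertical h s)); last first.
  by move=> w _; rewrite mul1r; exact: form_vertical_le (ltW sp).
have [n Hn HnS] : exists2 n, s * 24 <= cf_scale K h n ^+ 2 &
    cf_scale K h n.+1 ^+ 2 <= s * 24.
  have ex : exists m, cf_scale K h m ^+ 2 < s * 24.
    have s24 : 0 < s * 24 by rewrite mulr_gt0.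
    have [m Hm] : exists m, (3 / 4 : R) ^+ m < s * 24.
      by apply: geometric_lt => //; lra.
    exists m; apply: le_lt_trans Hm.
    have := cf_scale_le hK hS m; have := cf_scale_ge0 K h m.
    have : (3 / 4 : R) ^+ m <= 1 by rewrite exprn_ile1//; lra.
    set a := cf_scale _ _ _; set b := _ ^+ m => b1 a0 ab; nra.
  (* The least such index is positive, because [cf_scale K h 0] is 1 and [s <= 1 / 24]. *)
  have [m Hm mmin] := ex_minnP ex; case: m => [|n] in Hm mmin *.
    move: Hm; rewrite /cf_scale big_ord0 expr1n.
    by rewrite -ltr_pdivrMr// mul1r ltNge s1.
  exists n; last exact: ltW.
  by rewrite leNgt; apply/negP => /mmin; rewrite ltnn.
have [A [l [AP Al lE Ale]]] := cf_matrix hK hS (fun i (_ : (i < n)%N) => r0 i).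
have L0 : 0 < cf_scale K h n by exact: cf_scale_gt0.
have eL : e * cf_scale K h n <= cf_scale K h n.+1.
  by rewrite cf_scaleS mulrC ler_wpM2l// ltW.
set L := cf_scale K h n in Hn eL L0 lE *.
move=> w wN; have [_ AU] := AP; rewrite -AU.
set X := A *m _; set F := nm (X 0 0).
have XE : X = l *: homogeneous (rem n) + s%:C *: (A *m eoo).
  by rewrite /X homogeneous_vertical mulmxDr Al -scalemxAr.
(* The contribution of infinity to the first coordinate is small: [s <= L^2 / 24], and the
   denominator times [L] is at most 12. *)
have F0 : nm (X 0 0 - l) * L <= L ^+ 2 / 2.
  rewrite XE mxE mxE homogeneous0 mulr1 addrAC subrr add0r mxE.
  rewrite modulusM modulus_real ?(ltW sp)//.
  rewrite -mulrA -lE (le_trans (ler_wpM2l (ltW sp) Ale))//.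
  rewrite lE; lra.
have {}F0 : nm (X 0 0 - l) <= L / 2.
  by move: F0; rewrite expr2 -mulrA [L / 2]mulrC mulrA ler_pM2r// mulrC.
have FL : F <= L + L / 2.
  rewrite /F -(subrK l (X 0 0)) (le_trans (modulusD _ _))//.
  by rewrite lE addrC lerD2l.
have LF : L / 2 <= F.
  have := modulusB (X 0 0) (X 0 0 - l); rewrite subKr lE -/F; lra.
have FP : 0 < F by lra.
have X0 : X 0 0 != 0 by rewrite -modulus_gt0.
have XX : - complex.Re (hf X X) / 2 = s.
  rewrite AU Re_form_homogeneous depth_vertical// opprK.
  by rewrite -[s *+ 2]mulr_natr mulfK.
(* Both conditions of [null_form_ge] follow from [L / 2 <= F <= 3 L / 2], [e <= 1] and
   [e^2 L^2 <= 24 s]. *)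
have H : e ^+ 2 * L / 36 <= nm (hf X (A *m w)).
  apply: null_form_ge => //; first exact: picard_null_vector.
    rewrite XX -/F ler_pdivlMr//.
    have : (e * L) ^+ 2 <= s * 24.
      apply: le_trans HnS; rewrite ler_sqr ?nnegrE ?mulr_ge0 ?cf_scale_ge0//;
      exact: ltW.
    rewrite exprMn => H1.
    have : e ^+ 2 * L / 36 * F <= e ^+ 2 * L / 36 * (L + L / 2).
      by rewrite ler_wpM2l// divr_ge0// mulr_ge0 ?sqr_ge0// ltW.
    move=> H2; rewrite (le_trans H2)//.
    rewrite (_ : _ * _ = e ^+ 2 * L ^+ 2 / 24); first lra.
    by field.
  rewrite -/F; apply: le_trans LF.
  have e21 : e ^+ 2 <= 1 by rewrite exprn_ile1// ltW.
  have : e ^+ 2 * L <= L by rewrite ler_piMl// ltW.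
  lra.
have t0 : 0 <= e ^+ 2 * L / 36 by rewrite divr_ge0// mulr_ge0 ?sqr_ge0// ltW.
apply: (@le_trans _ _ ((e ^+ 2 * L / 36) ^+ 2)); last first.
  by rewrite ler_sqr ?nnegrE ?modulus_ge0.
rewrite (_ : (_ / 36) ^+ 2 = e ^+ 4 / 54 * (L ^+ 2 / 24)); last by field.
rewrite ler_wpM2l ?divr_ge0 ?exprn_ge0 ?(ltW e0)//; lra.
Qed.

Lemma bounded_digitsP :
  bounded_digits K h <-> exists2 c, 0 < c & null_gap h c.
Proof.
split; first exact: bounded_digits_gap.
by move=> [c c0 Hc]; exact: gap_bounded_digits c0 Hc.
Qed.

End BoundedDigits.

(** * The hyperbolic cosine and its inverse *)

Section HyperbolicCosine.
Variable R : realType.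

Definition ch (t : R) := (expR t + expR (- t)) / 2.

Lemma arcosh_eq (a t : R) : 1 <= a -> arcosh a = t -> a = ch t.
Proof.
move=> a1 <-; rewrite /arcosh.
have a2 : 0 <= a ^+ 2 - 1 by rewrite subr_ge0 expr_ge1//; lra.
have r0 := sqrtr_ge0 (a ^+ 2 - 1).
have rE : Num.sqrt (a ^+ 2 - 1) ^+ 2 = a ^+ 2 - 1 by rewrite sqr_sqrtr.
set r := Num.sqrt _ in r0 rE *.
have ar : 0 < a + r by lra.
have E : (a + r)^-1 = a - r.
  apply: (mulfI (lt0r_neq0 ar)); rewrite divff ?lt0r_neq0//.
  have : (a + r) * (a - r) = a ^+ 2 - r ^+ 2 by ring.
  by move=> ->; rewrite rE; ring.
rewrite /ch expRN lnK ?posrE// E; lra.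
Qed.

Lemma arcosh_ch (t : R) : 0 <= t -> arcosh (ch t) = t.
Proof.
move=> t0; rewrite /arcosh.
have -> : ch t ^+ 2 - 1 = ((expR t - expR (- t)) / 2) ^+ 2.
  have : expR t * expR (- t) = 1 by rewrite -expRD subrr expR0.
  by rewrite /ch; set a := expR t; set b := expR (- t) => ab; field: ab.
rewrite sqrtr_sqr ger0_norm; last first.
  by rewrite divr_ge0// subr_ge0 ler_expR; lra.
rewrite /ch (_ : _ + _ = expR t) ?expRK//; lra.
Qed.

Lemma ch_le (t : R) : 0 <= t -> ch t <= expR t.
Proof.
move=> t0; have : expR (- t) <= expR t by rewrite ler_expR; lra.
by rewrite /ch; lra.
Qed.

Lemma ch_ge (t : R) : expR t / 2 <= ch t.
Proof. by have := expR_ge0 (- t); rewrite /ch; lra. Qed.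

Lemma chN (t : R) : ch (- t) = ch t.
Proof. by rewrite /ch opprK addrC. Qed.

End HyperbolicCosine.

(** * Distances and the vertical geodesic ray *)

Section HyperbolicPlane.
Variable R : realType.
Local Notation nm := (@Normc.normc R).
Local Notation hf := (@hermitian_form R).
Local Notation C := R[i].
Implicit Types (p h : C2 R) (x y : @hplane R) (z w X : 'cV[C]_3) (A : 'M[C]_3).

Lemma hplane_depth p : hplane p <-> 0 < depth p.
Proof. by rewrite /hplane /depth /= subr_gt0. Qed.

Lemma val_depth x : 0 < depth (val x).
Proof. by apply/hplane_depth/set_mem/valP. Qed.

Definition hpoint p (pH : hplane p) : @hplane R := SigSub (mem_set pH).

Lemma form_homogeneous p :
  hf (homogeneous p) (homogeneous p) = (- depth p)%:C.
Proof.
apply/eqP; rewrite eq_complex /= -Re_form_homogeneous eqxx /=.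
rewrite hermitian_form_homogeneous !homogeneousE.
by case: p => [[a b] [c d]] /=; apply/eqP; ring.
Qed.

Lemma hyp_distE x y : hyp_dist x y =
  2 * arcosh (nm (hf (homogeneous (val x)) (homogeneous (val y))) /
              Num.sqrt (depth (val x) * depth (val y))).
Proof.
rewrite /hyp_dist !form_homogeneous; congr (2 * arcosh (_ / Num.sqrt _)).
by rewrite -rmorphM /= mulrNN.
Qed.

(** By [hermitian_form_ge] and AM-GM the argument of [arcosh] is at least 1, so [arcosh] can be
    inverted. *)
Lemma hyp_dist_form x y (t : R) : hyp_dist x y = t ->
  nm (hf (homogeneous (val x)) (homogeneous (val y))) ^+ 2 =
  depth (val x) * depth (val y) * ch (t / 2) ^+ 2.
Proof.
have dx := val_depth x; have dy := val_depth y.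
have H := hermitian_form_ge (val x) (val y).
rewrite hyp_distE; set d := depth _ in dx H *; set d' := depth _ in dy H *.
set N := nm _ in H *; have dd : 0 < d * d' by rewrite mulr_gt0.
have s0 : 0 < Num.sqrt (d * d') by rewrite sqrtr_gt0.
move=> E; have {}E : arcosh (N / Num.sqrt (d * d')) = t / 2.
  by move: E; lra.
have /arcosh_eq/(_ E) <- : 1 <= N / Num.sqrt (d * d').
  rewrite ler_pdivlMr// mul1r; apply: le_trans H.
  have S : 0 <= d + d' by lra.
  rewrite -ler_sqr ?nnegrE ?sqrtr_ge0 ?divr_ge0//.
  rewrite sqr_sqrtr ?(ltW dd)// -subr_ge0.
  rewrite (_ : _ - _ = ((d - d') / 2) ^+ 2) ?sqr_ge0//; by field.
rewrite exprMn exprVn sqr_sqrtr ?(ltW dd)// mulrC mulfVK//.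
exact: lt0r_neq0.
Qed.

Lemma vertical_hplane h (s : R) : siegel h -> 0 < s -> hplane (vertical h s).
Proof.
by move=> hS s0; apply/hplane_depth; rewrite depth_vertical// pmulrn_rgt0.
Qed.

Definition vertical_ray h (hS : siegel h) (t : R) : @hplane R :=
  hpoint (vertical_hplane hS (expR_gt0 (- t))).

(** At heights [e^-s] and [e^-t] the argument of [arcosh] is [(e^-s + e^-t) / (2 e^(-(s + t) / 2))],
    which is the hyperbolic cosine of [(s - t) / 2]. *)
Lemma vertical_ray_geodesic h (hS : siegel h) : geodesic_ray (vertical_ray hS).
Proof.
move=> s t _ _; rewrite hyp_distE /= !depth_vertical//.
rewrite form_vertical hermitian_form_homogeneous !homogeneousE (siegelE hS).
have -> : h.2 + (h.2)^*%C - 1 * (vertical h (expR (- t))).2^*%C - h.2 -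
    (expR (- s))%:C * 1^*%C = - (expR (- s) + expR (- t))%:C.
  case: (h) => [h1 [c d]]; apply/eqP; rewrite eq_complex /=.
  by apply/andP; split; apply/eqP; ring.
rewrite normcN modulus_real ?addr_ge0 ?expR_ge0//.
have -> : expR (- s) *+ 2 * (expR (- t) *+ 2) = (expR (- (s + t) / 2) *+ 2) ^+ 2.
  have H : expR (- (s + t) / 2) ^+ 2 = expR (- s) * expR (- t).
    by rewrite expr2 -!expRD; congr expR; field.
  move: H; set a := expR (_ / 2); set b := expR _; set c := expR _ => H.
  by ring: H.
rewrite sqrtr_sqr ger0_norm ?mulrn_wge0 ?expR_ge0//.
have -> : (expR (- s) + expR (- t)) / (expR (- (s + t) / 2) *+ 2) =
    ch (`|s - t| / 2).
  have -> : ch (`|s - t| / 2) = ch ((s - t) / 2).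
    by case: (ger0P (s - t)) => // _; rewrite mulNr chN.
  have -> : expR (- s) = expR (- (s + t) / 2) * expR (- ((s - t) / 2)).
    by rewrite -expRD; congr expR; field.
  have -> : expR (- t) = expR (- (s + t) / 2) * expR ((s - t) / 2).
    by rewrite -expRD; congr expR; field.
  rewrite /ch; have := expR_gt0 (- (s + t) / 2).
  by move: (expR (- (s + t) / 2)) => a a0; field; rewrite gt_eqF.
by rewrite arcosh_ch ?divr_ge0//; lra.
Qed.

End HyperbolicPlane.

(** * Reduction of points modulo the Picard group *)

Section Reduction.
Variable R : realType.
Local Notation nm := (@Normc.normc R).
Local Notation C := R[i].
Implicit Types (p h : C2 R) (z w X : 'cV[C]_3) (A : 'M[C]_3).

Lemma picard_group1 : picard_group (1%:M : 'M[C]_3).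
Proof.
split=> [i j|z w]; last by rewrite !mul1mx.
by rewrite mxE; exact: gaussian_int_bool.
Qed.

(** A vector with zero first coordinate has [<z, z> = |z_1|^2 >= 0], while the form is negative on
    lifts of interior points. *)
Lemma hplane_image p A : picard_group A -> 0 < depth p ->
  (A *m homogeneous p) 0 0 != 0.
Proof.
move=> [_ AU] p0; apply/eqP => X0.
have := Re_form_homogeneous p; rewrite -AU Re_hermitian_formzz X0.
rewrite mul0r /= mul0rn subr0 => H.
have := sqr_ge0 (nm ((A *m homogeneous p) 1 0)).
by rewrite H oppr_ge0 leNgt p0.
Qed.

(* Among the images of [p], one of nearly maximal depth that has been translated
   close to the vertical axis cannot gain depth under the inversion. *)
Lemma picard_reduction p (m : R) : 0 < m -> 0 < depth p ->
    (forall A, picard_group A -> m <= nm ((A *m homogeneous p) 0 0)) ->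
  exists A l q, [/\ picard_group A, l != 0,
    A *m homogeneous p = l *: homogeneous q &
    [/\ 4^-1 <= depth q, depth q <= depth p / m ^+ 2, nm q.1 ^+ 2 <= 3 / 2 &
        `|complex.Im q.2| <= 3 / 4]].
Proof.
move=> m0 p0 Hm.
pose E : set R := [set nm ((A *m homogeneous p) 0 0) | A in @picard_group R].
have E0 : E !=set0.
  exists (nm ((1%:M *m homogeneous p) 0 0)), 1%:M => //.
  exact: picard_group1.
have Em : lbound E m by move=> _ [A AP <-]; exact: Hm.
have mE : m <= inf E by exact: lb_le_inf.
(* With [|X_0| <= 8/7 inf E] the inversion test gives [|q.2| >= 7/8]. Since [|q.2| <= 3/4 + D / 2],
   this leaves [D >= 1/4]. *)
have I0 : 0 < inf E / 7 by rewrite divr_gt0// (lt_le_trans m0).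
have [|_ [A AP <-]] := @inf_adherent R E _ I0; first by split=> //; exists m.
set X := A *m homogeneous p => XE.
have X0 : X 0 0 != 0 by exact: hplane_image.
pose D := depth (affine X).
have DE : D = depth p / nm (X 0 0) ^+ 2.
  by case: AP => _ AU; rewrite /D depth_affine// AU Re_form_homogeneous opprK.
have D0 : 0 < D by rewrite DE divr_gt0// exprn_gt0// modulus_gt0.
(* The point is lowered vertically to the boundary, where the lattice reduction applies. *)
pose sh : C2 R := ((affine X).1, (affine X).2 - (D / 2)%:C).
have shS : siegel sh.
  have ReB (v : C) : complex.Re (v - (D / 2)%:C) = complex.Re v - D / 2.
    by case: v.
  have H : D = complex.Re (affine X).2 *+ 2 - nm (affine X).1 ^+ 2 by [].
  by apply/siegel_depth0; rewrite /depth [sh.1]/= [sh.2]/= ReB; lra.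
have [g gZ Hg] := siegelZ_reduction shS; have gP := translation_picard gZ.
pose q := heis_mul g (affine X).
have qE : q = ((heis_mul g sh).1, (heis_mul g sh).2 + (D / 2)%:C).
  by rewrite /q /heis_mul /sh /=; congr pair; ring.
have AX : translation_mx g *m X = X 0 0 *: homogeneous q.
  by rewrite {1}(affineK X0) -scalemxAr translation_homogeneous.
exists (translation_mx g *m A), (X 0 0), q; split=> //.
- exact: picard_groupM.
- by rewrite -mulmxA AX.
have dq : depth q = D.
  apply: oppr_inj; rewrite -Re_form_homogeneous /q -translation_homogeneous.
  by rewrite translation_form ?Re_form_homogeneous//; case: gZ.
(* Inverting the translated point is again an element of the group, so its first coordinate is
   subject to the infimum. *)
have q2 : inf E <= nm (X 0 0) * nm q.2.
  apply: ge_inf; first by exists m.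
  exists (form_mx R *m (translation_mx g *m A)).
    by apply: picard_groupM; [exact: form_mx_picard|exact: picard_groupM].
  rewrite -!mulmxA -/X AX; have [-> _ _] := form_mxE (X 0 0 *: homogeneous q).
  by rewrite normcN mxE homogeneous2 modulusM.
have XP : 0 < nm (X 0 0) by rewrite modulus_gt0.
have q78 : 7 / 8 <= nm q.2.
  by rewrite -(ler_pM2l XP) (le_trans _ q2)//; lra.
have D2 : 0 <= D / 2 by lra.
rewrite dq; split.
- have : nm q.2 <= nm (heis_mul g sh).2 + D / 2.
    by rewrite qE (le_trans (modulusD _ _))// modulus_real.
  lra.
- rewrite DE ler_wpM2l ?(ltW p0)// lef_pV2 ?posrE ?exprn_gt0//.
  rewrite ler_sqr ?nnegrE ?modulus_ge0 ?(ltW m0)//.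
  exact: Hm.
- have gS : siegel g by case: gZ.
  have := siegel_modulus1 (siegel_mul gS shS).
  have -> : (heis_mul g sh).1 = q.1 by rewrite qE.
  lra.
have -> : complex.Im q.2 = complex.Im (heis_mul g sh).2.
  by rewrite qE; case: (heis_mul g sh).2 => a b /=; rewrite addr0.
rewrite -ler_sqr ?nnegrE//.
have : nm (heis_mul g sh).2 ^+ 2 <= (3 / 4) ^+ 2.
  by rewrite ler_sqr ?nnegrE ?modulus_ge0//; lra.
rewrite real_normK ?num_real// modulus_sqr.
have := sqr_ge0 (complex.Re (heis_mul g sh).2); lra.
Qed.

End Reduction.

(** * Convergence in the complex numbers by real radii *)

Section ComplexTopology.
Variable R : realType.
Local Notation nm := (@Normc.normc R).
Local Notation C := R[i].

Lemma gt0_complex (e : C) : 0 < e -> e = (complex.Re e)%:C /\ 0 < complex.Re e.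
Proof.
by case: e => a b; rewrite ltcE /= => /andP[/eqP -> a0]; split.
Qed.

(** The norm of [C^o] is complex-valued, but positive elements of [C] are real. *)
Lemma cvg_complexP (T : Type) (F : set_system T) (FF : Filter F) (f : T -> C)
    (l : C) :
  (f t : C^o) @[t --> F] --> (l : C^o) <->
  forall e : R, 0 < e -> \forall t \near F, nm (l - f t) < e.
Proof.
split=> [/cvgrPdist_lt H e e0|H].
  have e0' : 0 < (e%:C : C) by rewrite ltcR.
  by apply: filterS (H _ e0') => t; rewrite ltcR.
apply/cvgrPdist_lt => e /gt0_complex[-> e0].
by apply: filterS (H _ e0) => t; rewrite ltcR.
Qed.

Lemma continuous_complex (T : topologicalType) (f g : T -> R) :
  continuous f -> continuous g -> continuous (fun x => (f x +i* g x : C^o)).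
Proof.
move=> fc gc x; apply/cvg_complexP => e e0.
have e2 : 0 < e / 2 by rewrite divr_gt0.
have /cvgrPdist_lt/(_ _ e2) Hf := fc x.
have /cvgrPdist_lt/(_ _ e2) Hg := gc x.
apply: filterS2 Hf Hg => y Hf Hg.
have -> : (f x +i* g x) - (f y +i* g y) =
    (f x - f y)%:C + (g x - g y)%:C * 'i.
  by apply/eqP; rewrite eq_complex /=; apply/andP; split; apply/eqP; ring.
rewrite (le_lt_trans (modulusD _ _))// modulusM.
have nr (a : R) : nm a%:C = `|a| by rewrite /= expr0n addr0 sqrtr_sqr.
rewrite !nr (_ : nm 'i = 1); last by rewrite /= expr0n expr1n add0r sqrtr1.
rewrite mulr1; lra.
Qed.

Lemma continuous_modulus : continuous (nm : C^o -> R).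
Proof.
move=> a; have FF := nbhs_filter (a : C^o).
apply: (@cvgrPdist_lt _ _ _ _ FF _ _).2 => e e0.
have H := (cvg_complexP FF id a).1 cvg_id e e0.
apply: (@filterS _ (nbhs (a : C^o)) _ _ _ _ H) => b; apply: le_lt_trans.
rewrite ler_norml; apply/andP; split.
  rewrite lerNl opprB lerBlDr -[X in nm X](subrK a).
  by rewrite (le_trans (modulusD _ _))// modulusBC.
by rewrite lerBlDr -{1}(subrK b a) modulusD.
Qed.

Lemma continuous_Re : continuous (@complex.Re R : C^o -> R).
Proof.
move=> a; have FF := nbhs_filter (a : C^o).
apply: (@cvgrPdist_lt _ _ _ _ FF _ _).2 => e e0.
have H := (cvg_complexP FF id a).1 cvg_id e e0.
apply: (@filterS _ (nbhs (a : C^o)) _ _ _ _ H) => b; apply: le_lt_trans.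
rewrite -raddfB /= ler_norml Re_le_modulus andbT lerNl -normcN.
by rewrite (le_trans _ (Re_le_modulus _))//; case: (a - b).
Qed.

End ComplexTopology.

(** * Compact sets of orbits, and bounded rays from the gap *)

Section OrbitSpace.
Variable R : realType.
Local Notation nm := (@Normc.normc R).
Local Notation hf := (@hermitian_form R).
Local Notation C := R[i].
Implicit Types (p h : C2 R) (x y : @hplane R) (z w X : 'cV[C]_3) (A : 'M[C]_3).

Lemma orbit_ofP x y : orbit_of x = orbit_of y <-> same_orbit x y.
Proof. by split=> [/eqmodP|H]; [|apply/eqmodP]. Qed.

Lemma orbit_of_surj (o : picard_quotient R) : exists x, orbit_of x = o.
Proof. by exists (repr o); rewrite /orbit_of reprK. Qed.

Lemma orbit_of_continuous :
  continuous (@orbit_of R : @hplane R -> picard_quotient R).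
Proof. exact: pi_continuous. Qed.

Local Notation R4 := (R * R * R * R)%type.

(** The last parameter is the logarithm of the depth, so all of [R4] parametrizes [hplane] and
    compact boxes have compact images. *)
Definition chart_point (r : R4) : C2 R :=
  (r.1.1.1 +i* r.1.1.2,
   ((expR r.2 + (r.1.1.1 ^+ 2 + r.1.1.2 ^+ 2)) / 2) +i* r.1.2).

Lemma depth_chart r : depth (chart_point r) = expR r.2.
Proof. by rewrite /depth /chart_point modulus_sqr /=; field. Qed.

Lemma chart_hplane r : hplane (chart_point r).
Proof. by apply/hplane_depth; rewrite depth_chart expR_gt0. Qed.

Definition chart r : @hplane R := hpoint (chart_hplane r).

Lemma chart_continuous : continuous (chart : R4 -> @hplane R).
Proof.
have c1 : continuous (fun r : R4 => r.1.1.1).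
  by move=> r; apply: cvg_comp; [apply: cvg_comp; exact: cvg_fst|exact: cvg_fst].
have c2 : continuous (fun r : R4 => r.1.1.2).
  by move=> r; apply: cvg_comp; [apply: cvg_comp; exact: cvg_fst|exact: cvg_snd].
have c3 : continuous (fun r : R4 => r.1.2).
  by move=> r; apply: cvg_comp; [exact: cvg_fst|exact: cvg_snd].
have c4 : continuous (fun r : R4 => expR r.2).
  by move=> r; apply: cvg_comp; [exact: cvg_snd|exact: continuous_expR].
have cM (f g : R4 -> R) : continuous f -> continuous g ->
    continuous (fun r => f r * g r).
  by move=> fc gc r'; apply: cvgM; [exact: fc|exact: gc].
have cD (f g : R4 -> R) : continuous f -> continuous g ->
    continuous (fun r => f r + g r).
  by move=> fc gc r'; apply: cvgD; [exact: fc|exact: gc].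
have cp (f g : R4 -> C^o) : continuous f -> continuous g ->
    continuous (fun r => (f r, g r) : C2 R).
  move=> fc gc r'.
  apply: (@cvg_pair _ _ _ (nbhs r') (nbhs (f r')) (nbhs (g r'))).
    exact: fc.
  exact: gc.
apply: (@continuous_comp_initial _ _ _ set_val).
apply: (cp (fun r => r.1.1.1 +i* r.1.1.2) (fun r => _ +i* _));
  apply: continuous_complex => //.
apply: (cM (fun r => expR r.2 + (r.1.1.1 ^+ 2 + r.1.1.2 ^+ 2)) (fun=> 2^-1)).
  apply: (cD (fun r => expR r.2)) => //.
  apply: (cD (fun r => r.1.1.1 ^+ 2) (fun r => r.1.1.2 ^+ 2)).
    exact: (cM (fun r => r.1.1.1) (fun r => r.1.1.1)).
  exact: (cM (fun r => r.1.1.2) (fun r => r.1.1.2)).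
by move=> r'; exact: cvg_cst.
Qed.

Definition box (d : R) : set R4 :=
  `[-2, 2] `*` `[-2, 2] `*` `[-1, 1] `*` `[ln 4^-1, ln d].

Lemma box_compact d : compact (box d).
Proof. by repeat apply: compact_setX; exact: segment_compact. Qed.

Lemma box_orbits_compact d :
  compact ((fun r => orbit_of (chart r) : picard_quotient R) @` box d).
Proof.
apply: continuous_compact; last exact: box_compact.
apply: continuous_subspaceT => r.
apply: continuous_comp; first exact: chart_continuous.
exact: orbit_of_continuous.
Qed.

Lemma chart_surj q d : 4^-1 <= depth q -> depth q <= d ->
    nm q.1 ^+ 2 <= 3 / 2 -> `|complex.Im q.2| <= 3 / 4 ->
  exists2 r, box d r & chart_point r = q.
Proof.
case: q => [[a b] [c t]] q4 qd; rewrite modulus_sqr /= => q1 q2.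
have q0 : 0 < depth ((a +i* b, c +i* t) : C2 R) by lra.
have sq (e f : R) : e ^+ 2 + f ^+ 2 <= 3 / 2 -> -2 <= e <= 2.
  by move=> ef; have := sqr_ge0 f => f0; apply/andP; split; nra.
exists (a, b, t, ln (depth ((a +i* b, c +i* t) : C2 R))).
  split; [split; [split|]|]; rewrite /= in_itv /=.
  - exact: sq q1.
  - by apply: (sq _ a); lra.
  - by move: q2; rewrite ler_norml => /andP[? ?]; apply/andP; split; lra.
  - by rewrite !ler_ln ?posrE ?q4 ?qd//; lra.
rewrite /chart_point /= lnK ?posrE// /depth modulus_sqr /=.
by congr (_, _ +i* _); field.
Qed.

(** At height [s] the depth is [2 s], and by [vertical_gap] every image has squared first coordinate
    at least [e s]. The reduction thus leads to depth at most [2 s / (e s) = 2 / e], inside a fixed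
    box. *)
Lemma gap_bounded_ray h c : siegel h -> 0 < c -> null_gap h c ->
  bounded_ray_endpoint h.
Proof.
move=> hS c0 Hc; have [e e0 He] := vertical_gap hS c0 Hc.
exists (vertical_ray hS); split; first exact: vertical_ray_geodesic.
  suff : ((h.1, h.2 + (expR (- t))%:C) : C2 R) @[t --> +oo] -->
      ((h.1, h.2) : C2 R) by rewrite -surjective_pairing.
  apply: (@cvg_pair _ _ _ _ (nbhs (h.1 : C^o)) (nbhs (h.2 : C^o))).
    exact: cvg_cst.
  apply/cvg_complexP => d d0.
  have /cvgr0_norm_lt/(_ _ d0) := @cvgr_expR R; apply: filterS => t.
  rewrite ger0_norm ?expR_ge0// opprD addNKr normcN modulus_real// expR_ge0.
exists ((fun r => orbit_of (chart r) : picard_quotient R) @` box (2 / e)).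
  exact: box_orbits_compact.
move=> t t0; set s := expR (- t).
have s0 : 0 < s by exact: expR_gt0.
have s1 : s <= 1 by rewrite -expR0 ler_expR; lra.
have es : 0 < e * s by rewrite mulr_gt0.
have dE : depth (vertical h s) = s *+ 2 by exact: depth_vertical.
have dp : 0 < depth (vertical h s) by rewrite dE pmulrn_rgt0.
have m0 : 0 < Num.sqrt (e * s) by rewrite sqrtr_gt0.
have [A AP|A [l [q [AP l0 Aq [q4 qd q1 q2]]]]] := picard_reduction m0 dp.
  rewrite -ler_sqr ?nnegrE ?sqrtr_ge0 ?modulus_ge0// sqr_sqrtr ?(ltW es)//.
  (* Up to sign the first coordinate is the form with infinity; moving [A] across it gives the null
     vector [B *m eoo]. *)
  rewrite -normcN -hermitian_form_infinity.
  have [B BP BA] := picard_groupV AP; have AB := mulmx1C BA.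
  rewrite -[X in hf _ X]mul1mx -AB -mulmxA; case: (AP) => _ ->.
  by apply: He => //; exact/picard_null_vector/null_vector_infinity.
have {}qd : depth q <= 2 / e.
  move: qd; rewrite sqr_sqrtr ?(ltW es)// dE (_ : _ / _ = 2 / e)//.
  by field; rewrite !gt_eqF.
have [r rb rq] := chart_surj q4 qd q1 q2.
exists r => //; apply/esym/orbit_ofP/asboolP; exists A => //; exists l => //.
by rewrite /= rq.
Qed.

End OrbitSpace.

(** * Compact sets of orbits stay away from the cusps *)

Section RayGap.
Variable R : realType.
Local Notation nm := (@Normc.normc R).
Local Notation hf := (@hermitian_form R).
Local Notation C := R[i].
Implicit Types (p h : C2 R) (x y : @hplane R) (z w X : 'cV[C]_3) (A : 'M[C]_3).

Lemma continuous_affine (a b c : C) :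
  continuous (fun p : C2 R => a + b * p.1 + c * p.2 : C^o).
Proof.
have H (d : C) (f : C2 R -> C^o) : continuous f ->
    continuous (fun p => d * f p : C^o).
  move=> fc p; apply: (@cvgM _ _ (nbhs p) _ (fun=> d) f); last exact: fc.
  exact: cvg_cst.
have D (f g : C2 R -> C^o) : continuous f -> continuous g ->
    continuous (fun p => f p + g p : C^o).
  by move=> fc gc p; apply: (@cvgD _ _ _ (nbhs p) _ f g); [exact: fc|exact: gc].
apply: (D (fun p => a + b * p.1) (fun p => c * p.2)); last first.
  by apply: (H c (fun p => p.2)) => p; exact: cvg_snd.
apply: (D (fun=> a) (fun p => b * p.1)); first by move=> p; exact: cvg_cst.
by apply: (H b (fun p => p.1)) => p; exact: cvg_fst.
Qed.

Lemma continuous_modulus_affine (a b c : C) :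
  continuous (fun p : C2 R => nm (a + b * p.1 + c * p.2)).
Proof.
move=> p; apply: (@continuous_comp _ C^o _
  (fun p : C2 R => a + b * p.1 + c * p.2) nm); first exact: continuous_affine.
exact: continuous_modulus.
Qed.

Lemma continuous_form z : continuous (fun p => nm (hf z (homogeneous p))).
Proof.
have E : (fun p => nm (hf z (homogeneous p))) =
    (fun p => nm (- (z 2 0)^*%C + (z 1 0)^*%C * p.1 + - (z 0 0)^*%C * p.2)).
  apply/funext => p; rewrite -modulus_formC /hermitian_form !homogeneousE.
  by congr nm; ring.
by rewrite E; exact: continuous_modulus_affine.
Qed.

Lemma continuous_image0 A :
  continuous (fun p => nm ((A *m homogeneous p) 0 0)).
Proof.
have E : (fun p => nm ((A *m homogeneous p) 0 0)) =
    (fun p => nm (A 0 0 + A 0 1 * p.1 + A 0 2 * p.2)).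
  apply/funext => p; rewrite mxE sum_ord3 !homogeneousE; congr nm.
  by rewrite mulr1.
by rewrite E; exact: continuous_modulus_affine.
Qed.

Lemma continuous_depth : continuous (@depth R : C2 R -> R).
Proof.
move=> p; apply: cvgB.
  apply: cvgMn.
  apply: (@continuous_comp _ _ _ (snd : C2 R -> C^o)); first exact: cvg_snd.
  exact: continuous_Re.
have H : {for p, continuous (fun p : C2 R => nm p.1)}.
  apply: (@continuous_comp _ _ _ (fst : C2 R -> C^o)); first exact: cvg_fst.
  exact: continuous_modulus.
by apply: cvgM; exact: H.
Qed.

(* The orbits of these sets form an increasing exhaustion of the orbit space by
   open sets, on which the distance to the cusps is bounded from below. *)
Definition thick (n : nat) : set (@hplane R) :=
  [set x | exists2 A, picard_group A &
    let a := nm ((A *m homogeneous (val x)) 0 0) ^+ 2 in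
    depth (val x) < n%:R * a /\ a < n%:R * depth (val x)].

Lemma open_lt_fun (T : topologicalType) (f g : T -> R) :
  continuous f -> continuous g -> open [set x | f x < g x].
Proof.
move=> fc gc; have -> : [set x | f x < g x] = (g \- f) @^-1` [set r | 0 < r].
  by apply/seteqP; split => x /=; rewrite subr_gt0.
apply: open_comp; last exact: open_gt.
by move=> x _; apply: cvgB; [exact: gc|exact: fc].
Qed.

Lemma thick_open n : open (thick n).
Proof.
have vc : continuous (val : @hplane R -> C2 R) by exact: initial_continuous.
have nc (f : @hplane R -> R) : continuous f -> continuous (fun x => n%:R * f x).
  move=> fc x; apply: (@cvgM _ _ (nbhs x) _ (fun=> n%:R) f); last exact: fc.
  exact: cvg_cst.
have dc : continuous (fun x : @hplane R => depth (val x)).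
  move=> x; apply: (@continuous_comp _ _ _ (val : @hplane R -> C2 R) (@depth R));
    first exact: vc.
  exact: continuous_depth.
have ac A : continuous (fun x : @hplane R =>
    nm ((A *m homogeneous (val x)) 0 0) ^+ 2).
  have H : continuous (fun x : @hplane R => nm ((A *m homogeneous (val x)) 0 0)).
    move=> x; apply: (@continuous_comp _ _ _ (val : @hplane R -> C2 R)
      (fun p => nm ((A *m homogeneous p) 0 0))).
      exact: vc.
    exact: continuous_image0.
  by move=> x; exact: (cvgM (H x) (H x)).
rewrite (_ : thick n = \bigcup_(A in @picard_group R)
    ([set x | depth (val x) < n%:R * nm ((A *m homogeneous (val x)) 0 0) ^+ 2] `&`
     [set x | nm ((A *m homogeneous (val x)) 0 0) ^+ 2 < n%:R * depth (val x)])).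
  apply: bigcup_open => A _; apply: openI; apply: open_lt_fun => //; exact: nc.
by apply/seteqP; split=> x [A AP H]; exists A.
Qed.

(** Depth and squared first coordinate both scale by [|l|^2], which cancels. *)
Lemma thick_orbit n x y : same_orbit x y -> thick n y -> thick n x.
Proof.
move=> /asboolP[B BP [l l0 Bx]] [A AP [H1 H2]].
exists (A *m B); first exact: picard_groupM.
have l2 : 0 < nm l ^+ 2 by rewrite exprn_gt0// modulus_gt0.
have dE : depth (val x) = nm l ^+ 2 * depth (val y).
  apply: oppr_inj; rewrite -mulrN -!Re_form_homogeneous -Re_formZ -Bx.
  by case: BP => _ ->.
have scE (v : 'cV[C]_3) : (l *: v) 0 0 = l * v 0 0 by rewrite mxE.
rewrite -mulmxA Bx -scalemxAr scE modulusM exprMn dE.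
by split; rewrite /= [n%:R * (_ * _)]mulrCA ltr_pM2l.
Qed.

Lemma thick_mono m n x : (m <= n)%N -> thick m x -> thick n x.
Proof.
move=> mn [A AP [H1 H2]]; exists A => //.
have d0 := val_depth x.
have mnR : (m%:R : R) <= n%:R by rewrite ler_nat.
split; [apply: lt_le_trans H1 _|apply: lt_le_trans H2 _];
by rewrite ler_wpM2r// ?sqr_ge0// ltW.
Qed.

Lemma thick_exhaustion x : exists n, thick n x.
Proof.
have d0 := val_depth x; set d := depth (val x) in d0.
have [n Hn] : exists n, d + d^-1 < n%:R.
  by exists (Num.truncn (d + d^-1)).+1; exact: truncnS_gt.
have di : 0 < d^-1 by rewrite invr_gt0.
exists n, 1%:M; first exact: picard_group1.
rewrite mul1mx homogeneous0 Normc.normc1 expr1n /= mulr1 -/d; split; first lra.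
by rewrite -ltr_pdivrMr// mul1r; lra.
Qed.

(** The sets of orbits of [thick n] are open, increase with [n] and cover, so one contains [Q]. *)
Lemma compact_thick (Q : set (picard_quotient R)) : compact Q ->
  exists n, forall x, Q (orbit_of x) -> thick n x.
Proof.
move=> /compact_near_coveringP/(_ nat \oo
  (fun n o => exists2 x, orbit_of x = o & thick n x)) H.
have [|N _ HN] := H.
- move=> o Qo; have [x xo] := orbit_of_surj o; have [n Hn] := thick_exhaustion x.
  exists ((@orbit_of R @` thick n : set (picard_quotient R)),
          [set m | (n <= m)%N]).
    split; last by exists n.
    apply: open_nbhs_nbhs; split; last by exists x.
    (* Openness in the quotient is openness of the preimage, which is [thick n] itself by
       invariance. *)
    rewrite /open /= /quotient_open.
    rewrite (_ : _ @^-1` _ = thick n); first exact: thick_open.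
    apply/seteqP; split=> y /=; last by exists y.
    move=> [y' Hy' /orbit_ofP y'y].
    by apply: thick_orbit Hy'; rewrite same_orbit_sym.
  move=> [q m] /= [[y Hy <-] le_nm]; exists y => //.
  exact: thick_mono le_nm Hy.
exists N => x Qx; have [y yx Hy] := HN N (leqnn N) _ Qx.
by apply: thick_orbit Hy; apply/orbit_ofP.
Qed.

(** [null_form_ge] for the image [X], with [t^2 = depth / (4 n)]: the upper bound on [|X_0|^2]
    serves the finite cusps, the lower bound the one at infinity. *)
Lemma thick_form n x w : thick n x -> null_vector w ->
  depth (val x) / (4 * n%:R) <= nm (hf (homogeneous (val x)) w) ^+ 2.
Proof.
move=> [A AP [H1 H2]] wN; have d0 := val_depth x.
have n0 : 0 < n%:R :> R.
  rewrite ltr0n lt0n; apply: contraTneq H1 => ->.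
  by rewrite mul0r -leNgt ltW.
have [_ AU] := AP; rewrite -AU; set X := A *m homogeneous (val x).
have X0 : X 0 0 != 0 by exact: hplane_image.
have X0' : 0 < nm (X 0 0) by rewrite modulus_gt0.
rewrite -/X in H1 H2; set d := depth _ in d0 H1 H2 *.
set a := nm (X 0 0) in X0' H1 H2 *.
have -> : d / (4 * n%:R) = Num.sqrt (d / (4 * n%:R)) ^+ 2.
  by rewrite sqr_sqrtr// divr_ge0 ?mulr_ge0 ?ltW.
have r0 := sqrtr_ge0 (d / (4 * n%:R)).
rewrite ler_sqr ?nnegrE ?modulus_ge0//.
apply: null_form_ge => //; first exact: picard_null_vector.
  rewrite AU Re_form_homogeneous opprK -/d -/a.
  rewrite -ler_sqr ?nnegrE ?divr_ge0 ?(ltW d0) ?(ltW X0')//.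
  rewrite sqr_sqrtr ?divr_ge0 ?mulr_ge0 ?(ltW d0)//.
  rewrite !exprMn exprVn ler_pdivrMr ?mulr_gt0//.
  rewrite (_ : _ * (4 * _) = d * (n%:R * d / a ^+ 2)); last first.
    by field; rewrite gt_eqF.
  rewrite ler_peMr ?(ltW d0)// ler_pdivlMr ?exprn_gt0// mul1r ltW//.
rewrite -/a -ler_sqr ?nnegrE ?(ltW X0')//.
rewrite sqr_sqrtr ?divr_ge0 ?mulr_ge0 ?(ltW d0)//.
rewrite ler_pdivrMr ?mulr_gt0//; have := mulr_gt0 n0 (exprn_gt0 2 X0'); lra.
Qed.

End RayGap.

(** * Geodesic rays ending at the given boundary point *)

Section RayAsymptotics.
Variable R : realType.
Local Notation nm := (@Normc.normc R).
Local Notation hf := (@hermitian_form R).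
Local Notation C := R[i].
Implicit Types (z w X : 'cV[C]_3).
Variables (c : R -> @hplane R) (h : C2 R).
Hypotheses (hS : siegel h) (cG : geodesic_ray c).
Hypothesis ch_cvg : (val (c t) : C2 R) @[t --> +oo] --> h.
Local Notation x t := (homogeneous (val (c t))).
Local Notation rho t := (depth (val (c t))).

Lemma ray_form_cvg s :
  nm (hf (x s) (x t)) @[t --> +oo] --> nm (hf (x s) (homogeneous h)).
Proof.
apply: (cvg_comp (fun t => val (c t) : C2 R)
  (fun p => nm (hf (x s) (homogeneous p))) ch_cvg).
exact: continuous_form.
Qed.

Lemma ray_formE s t : 0 <= s -> s <= t ->
  nm (hf (x s) (x t)) ^+ 2 = rho s * rho t * ch ((t - s) / 2) ^+ 2.
Proof.
move=> s0 st; apply: hyp_dist_form; rewrite cG//; last exact: le_trans st.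
by rewrite distrC ger0_norm// subr_ge0.
Qed.

Lemma expR_half (t : R) : expR (t / 2) ^+ 2 = expR t.
Proof. by rewrite expr2 -expRD; congr expR; field. Qed.

(* [<x_s, x_t>] is known from [cosh] and tends to [<x_s, h>] as [t] grows: the
   case [s = 0] gives the size of [rho t], and then [s = t] that of [<x_t, h>]. *)
Lemma ray_asymptotics : exists t0 a M, [/\ 0 <= t0, 0 < a, 0 < M &
  forall t, t0 <= t -> a * expR (- t) <= rho t /\
                       nm (hf (x t) (homogeneous h)) <= M * expR (- t)].
Proof.
pose b := nm (hf (x 0) (homogeneous h)).
have r0 := val_depth (c 0).
have b0 : 0 < b.
  apply: lt_le_trans (hermitian_form_ge _ _).
  by have /siegel_depth0 -> := hS; rewrite addr0 divr_gt0.
have [T [_ HT]] : \forall t \near +oo, b / 2 < nm (hf (x 0) (x t)) /\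
    nm (hf (x 0) (x t)) < b * 2.
  have H1 := cvgr_gt _ (@ray_form_cvg 0) (b / 2).
  have H2 := cvgr_lt _ (@ray_form_cvg 0) (b * 2).
  apply: filterI; [apply: H1|apply: H2]; rewrite -/b; lra.
pose t0 := Num.max 0 (T + 1).
have t00 : 0 <= t0 by rewrite le_max lexx.
(* From [e^t <= 4 ch(t/2)^2] and [N < 2 b] comes [rho 0 * rho t * e^t <= 4 N^2 <= 16 b^2]. *)
pose M := 16 * b ^+ 2 / rho 0.
have M0 : 0 < M by rewrite divr_gt0// mulr_gt0// exprn_gt0.
have main t : t0 <= t -> b ^+ 2 / (4 * rho 0) * expR (- t) <= rho t /\
    rho t <= M * expR (- t).
  move=> tt; have t1 : 0 <= t := le_trans t00 tt.
  have Tt : T < t.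
    apply: lt_le_trans tt; rewrite /t0 lt_max; apply/orP; right; lra.
  have [B1 B2] := HT t Tt; have := ray_formE (lexx 0) t1; rewrite subr0.
  set N := nm _ in B1 B2 *; have E := expR_half t.
  have t2 : 0 <= t / 2 by lra.
  have C1 := ch_le t2; have C2' := ch_ge (t / 2).
  have e0 := expR_gt0 (t / 2).
  have D1 : ch (t / 2) ^+ 2 <= expR t by rewrite -E ler_sqr ?nnegrE; lra.
  have D2 : expR t <= 4 * ch (t / 2) ^+ 2.
    rewrite -E (_ : 4 * _ = (2 * ch (t / 2)) ^+ 2); last by ring.
    by rewrite ler_sqr ?nnegrE; lra.
  have eN : expR t * expR (- t) = 1 by rewrite -expRD subrr expR0.
  have ei := expR_gt0 (- t); have ep := expR_gt0 t.
  have rt := val_depth (c t) => NE.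
  have rr : 0 < rho 0 * rho t by rewrite mulr_gt0.
  have N1 : b ^+ 2 / 4 <= rho 0 * rho t * expR t.
    apply: (@le_trans _ _ (N ^+ 2)); last by rewrite NE ler_wpM2l// ltW.
    rewrite (_ : _ / 4 = (b / 2) ^+ 2); last by field.
    by rewrite ler_sqr ?nnegrE; lra.
  have N2 : rho 0 * rho t * expR t <= 16 * b ^+ 2.
    apply: (@le_trans _ _ (4 * N ^+ 2)).
      by rewrite NE mulrCA ler_wpM2l// ltW.
    have : N ^+ 2 <= (b * 2) ^+ 2 by rewrite ler_sqr ?nnegrE; lra.
    by rewrite exprMn; lra.
  have rE : rho t = rho 0 * rho t * expR t * expR (- t) / rho 0.
    by rewrite -[_ * expR t * _]mulrA eN mulr1 mulrAC divff ?mul1r// gt_eqF.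
  split; rewrite rE.
    rewrite ler_pdivlMr// (_ : b ^+ 2 / (4 * rho 0) * expR (- t) * rho 0 =
      b ^+ 2 / 4 * expR (- t)).
      by rewrite ler_pM2r.
    by field; rewrite gt_eqF.
  by rewrite /M [leRHS]mulrAC ler_pM2r ?invr_gt0// ler_pM2r.
exists t0, (b ^+ 2 / (4 * rho 0)), M; split=> //.
  by rewrite divr_gt0 ?exprn_gt0// mulr_gt0.
move=> s ss; have [H1 H2] := main _ ss; split=> //.
(* For fixed [s] the bound [M e^-s] holds for all [t > s], since [e^-s e^-t e^(t - s) = e^(-2 s)],
   and so passes to the limit. *)
apply: (cvgr_to_le (@ray_form_cvg s)).
exists s; split; first exact: num_real.
move=> t /ltW st; have [_ H3] := main _ (le_trans ss st).
have s1 : 0 <= s := le_trans t00 ss.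
have ts2 : 0 <= (t - s) / 2 by rewrite divr_ge0// subr_ge0.
have es := expR_gt0 (- s); have et := expR_gt0 (- t).
have M1 : 0 <= M * expR (- s) by rewrite mulr_ge0// ltW.
rewrite -ler_sqr ?nnegrE ?modulus_ge0// ray_formE//.
have D : ch ((t - s) / 2) ^+ 2 <= expR (t - s).
  rewrite -expR_half ler_sqr ?nnegrE ?expR_ge0 ?ch_le//.
  by rewrite /ch divr_ge0// addr_ge0 ?expR_ge0.
have R0 : 0 <= rho s * rho t by rewrite mulr_ge0// ltW// val_depth.
have R1 : rho s * rho t <= (M * expR (- s)) * (M * expR (- t)).
  by rewrite ler_pM// ltW// val_depth.
apply: le_trans (ler_pM R0 (sqr_ge0 _) R1 D) _.
rewrite (_ : _ * expR (t - s) = (M * expR (- s)) ^+ 2)//.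
have -> : expR (- t) = expR (- s) * expR (- (t - s)).
  by rewrite -expRD; congr expR; ring.
have : expR (- (t - s)) * expR (t - s) = 1 by rewrite -expRD addNr expR0.
by set u := expR (- (t - s)); set v := expR (t - s) => uv; ring: uv.
Qed.

(** For [s = e^-t] the point [x_t] takes the place of the vertical one in [approach_gap]:
    [thick_form] with [rho t >= a s] bounds the form below, and [form_triangle] at [h] bounds it
    above. *)
Lemma bounded_ray_gap (Q : set (picard_quotient R)) : compact Q ->
    (forall t, 0 <= t -> Q (orbit_of (c t))) ->
  exists2 g, 0 < g & null_gap h g.
Proof.
move=> Qc Qray; have [n Hn] := compact_thick Qc.
have [t0 [a [M [t00 a0 M0 HT]]]] := ray_asymptotics.
have n0 : 0 < n%:R :> R.
  rewrite ltr0n lt0n; apply/eqP => n0.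
  have [A _ []] := Hn _ (Qray _ (lexx 0)).
  by rewrite n0 mul0r ltNge ltW// val_depth.
apply: (@approach_gap R h (a / (4 * n%:R)) (expR (- t0)) (2 * (M + 1))).
- by rewrite divr_gt0// mulr_gt0.
- exact: expR_gt0.
- by rewrite mulr_gt0// addr_gt0.
move=> s s0 s1; pose t := - ln s.
have sE : s = expR (- t) by rewrite opprK lnK.
have tt : t0 <= t by rewrite -lerN2 -ler_expR -sE.
have [H1 H2] := HT _ tt; rewrite -sE in H1 H2.
exists (x t) => w wN.
  have := thick_form (Hn _ (Qray _ (le_trans t00 tt))) wN; apply: le_trans.
  by rewrite mulrAC ler_pM2r// invr_gt0 mulr_gt0.
have [_ _ W] := wN.
have := form_triangle (X := x t) (w := w) hS.
rewrite Re_form_homogeneous W lexx oppr_le0 ltW ?val_depth//.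
move=> /(_ isT isT) /le_trans; apply.
rewrite homogeneous0 Normc.normc1 mul1r.
set e := nm (hf w _); set k := nm (hf (x t) _) in H2 *.
have e0 : 0 <= e by exact: modulus_ge0.
have k0 : 0 <= k * nm (w 0 0) by rewrite mulr_ge0 ?modulus_ge0.
have kM : k * nm (w 0 0) <= M * (s * nm (w 0 0)).
  by rewrite mulrA ler_wpM2r ?modulus_ge0.
have sw0 : 0 <= s * nm (w 0 0) by rewrite mulr_ge0 ?modulus_ge0 ?ltW.
(* The inequality [(x + y)^2 <= 2 (x^2 + y^2)] is the source of the factor 2 in the constant
   [2 * (M + 1)]. *)
have : (Num.sqrt (k * nm (w 0 0)) + Num.sqrt e) ^+ 2 <= 2 * (k * nm (w 0 0) + e).
  rewrite -{2}(sqr_sqrtr k0) -{2}(sqr_sqrtr e0).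
  have := sqr_ge0 (Num.sqrt (k * nm (w 0 0)) - Num.sqrt e).
  by rewrite sqrrB sqrrD; lra.
move=> /le_trans; apply.
have := mulr_ge0 (ltW M0) e0; lra.
Qed.

End RayAsymptotics.

Theorem theorem1p8 (R : realType) (K : set (C2 R)) (hK : dirichlet_region K)
    (h : C2 R) (hh : siegel h) :
  (badly_approximable h <-> bounded_digits K h) /\
  (bounded_digits K h <-> bounded_ray_endpoint h).
Proof.
have BD := bounded_digitsP hK hh.
split; first by rewrite badly_approximableP BD.
rewrite BD; split=> [[c c0 Hc]|[c [cG ch_cvg [Q Qc Qray]]]].
  exact: gap_bounded_ray c0 Hc.
exact: bounded_ray_gap cG ch_cvg Q Qc Qray.
Qed.
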